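(* Let $f:\mathbb{R}^n\to\mathbb{R}^n$ be continuous with $f(0)=0$, and consider the system $\dot x=f(x)$, $x(0)=x_0\in\mathbb{R}^n$. Let $\alpha,\beta,p,q,k>0$ be real numbers with $kp<1$ and $kq>1$, let $T_c>0$, and let $$\gamma=\frac{\Gamma(m_p)\,\Gamma(m_q)}{\alpha^{k}\,\Gamma(k)\,(q-p)}\left(\frac{\alpha}{\beta}\right)^{m_p},\qquad m_p=\frac{1-kp}{q-p},\quad m_q=\frac{kq-1}{q-p}.$$ Suppose there exists a continuous positive definite radially unbounded function $V:\mathbb{R}^n\to\mathbb{R}$ such that any solution $x(t,x_0)$ of the system satisfies $$\dot V(x)\le-\frac{\gamma}{T_c}\left(\alpha V(x)^p+\beta V(x)^q\right)^k\qquad\text{for all } x\in\mathbb{R}^n\setminus\{0\}.$$ Then the origin of the system is predefined-time stable and $T_c$ is a predefined time. If, in addition, equality holds in the displayed inequality, then $T_c$ is the strong predefined time.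
   Context: $\Gamma(z)=\int_0^{+\infty}e^{-t}t^{z-1}\,dt$ is the Gamma function. $\dot V(x)$ denotes the time derivative of $t\mapsto V(x(t,x_0))$ along solutions of the system, the inequality being required whenever $x(t,x_0)\neq 0$. Lyapunov stability: the origin is Lyapunov stable if for all $\epsilon>0$ there is $\delta=\delta(\epsilon)>0$ such that for all $\|x_0\|<\delta$, any solution $x(t,x_0)$ exists for all $t\ge 0$ and $\|x(t,x_0)\|<\epsilon$ for all $t\ge 0$. Global finite-time stability: the origin is globally finite-time stable if it is Lyapunov stable and for any $x_0\in\mathbb{R}^n$ there exists $0\le T<+\infty$ such that the solution satisfies $x(t,x_0)=0$ for all $t\ge T$. The settling-time function is $T(x_0)=\inf\{T : x(t,x_0)=0\ \forall t\ge T\}$. Fixed-time stability: the origin is fixed-time stable if it is globally finite-time stable and there exists $T_{\max}>0$ with $T(x_0)\le T_{\max}$ for all $x_0\in\mathbb{R}^n$. Predefined-time stability: for a constant $T_c>0$ (in general depending on the system parameters), the origin is predefined-time stable with predefined time $T_c$ if it is fixed-time stable and $T(x_0)\le T_c$ for all $x_0\in\mathbb{R}^n$. If moreover $\sup_{x_0\in\mathbb{R}^n}T(x_0)=T_c$, then $T_c$ is called the strong predefined time. *)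

(* Defs.v *)
From HB Require Import structures.
From mathcomp Require Import all_boot all_order all_algebra.
From mathcomp Require Import all_classical all_reals all_analysis.
Set Implicit Arguments.
Unset Strict Implicit.
Unset Printing Implicit Defensive.
Import Order.TTheory GRing.Theory Num.Theory.
Import numFieldNormedType.Exports.
Local Open Scope classical_set_scope.
Local Open Scope ring_scope.

Definition Gamma (R : realType) (z : R) : R :=
  Rintegral lebesgue_measure `]0, +oo[ (fun t : R => expR (- t) * t `^ (z - 1)).

(* Derivative relative to the time domain J: one-sided at an endpoint of J. *)
Definition has_deriv_in (R : realType) (W : normedModType R) (J : set R)
    (g : R -> W) (t : R) (d : W) : Prop :=
  (fun s => (s - t)^-1 *: (g s - g t)) @ within J t^' --> d.

Definition time_domain (R : realType) (tau : \bar R) : set R :=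
  [set t | 0 <= t /\ (t%:E < tau)%E].

(* Solutions are functions on R of which only the restriction to [0, tau[
   matters. Since f is only assumed continuous, solutions need not be unique. *)
Definition is_solution (R : realType) (n : nat) (f : 'rV[R]_n -> 'rV[R]_n)
    (x0 : 'rV[R]_n) (tau : \bar R) (x : R -> 'rV[R]_n) : Prop :=
  [/\ (0 < tau)%E, x 0 = x0 &
      forall t, time_domain tau t ->
        has_deriv_in (time_domain tau) x t (f (x t))].

Definition is_maximal_solution (R : realType) (n : nat)
    (f : 'rV[R]_n -> 'rV[R]_n) (x0 : 'rV[R]_n) (tau : \bar R)
    (x : R -> 'rV[R]_n) : Prop :=
  is_solution f x0 tau x /\
  forall (tau' : \bar R) (y : R -> 'rV[R]_n),
    (tau <= tau')%E -> is_solution f x0 tau' y ->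
    (forall t, time_domain tau t -> y t = x t) -> tau' = tau.

Definition is_global_solution (R : realType) (n : nat)
    (f : 'rV[R]_n -> 'rV[R]_n) (x0 : 'rV[R]_n) (x : R -> 'rV[R]_n) : Prop :=
  is_solution f x0 +oo%E x.

(* "Any solution starting at x0 exists for all t >= 0"; the first conjunct keeps
   quantifications over global solutions from being vacuous. *)
Definition solutions_exist_forever (R : realType) (n : nat)
    (f : 'rV[R]_n -> 'rV[R]_n) (x0 : 'rV[R]_n) : Prop :=
  (exists x, is_global_solution f x0 x) /\
  (forall tau x, is_maximal_solution f x0 tau x -> tau = +oo%E).

Definition lyapunov_stable (R : realType) (n : nat)
    (f : 'rV[R]_n -> 'rV[R]_n) : Prop :=
  forall eps : R, 0 < eps -> exists2 delta : R, 0 < delta &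
    forall x0 : 'rV[R]_n, `|x0| < delta ->
      solutions_exist_forever f x0 /\
      forall x, is_global_solution f x0 x -> forall t, 0 <= t -> `|x t| < eps.

Definition vanishes_after (R : realType) (n : nat)
    (f : 'rV[R]_n -> 'rV[R]_n) (x0 : 'rV[R]_n) (T : R) : Prop :=
  forall x, is_global_solution f x0 x -> forall t, T <= t -> x t = 0.

Definition globally_finite_time_stable (R : realType) (n : nat)
    (f : 'rV[R]_n -> 'rV[R]_n) : Prop :=
  lyapunov_stable f /\
  forall x0 : 'rV[R]_n, solutions_exist_forever f x0 /\
    exists2 T : R, 0 <= T & vanishes_after f x0 T.

(* Taken in \bar R, so that the infimum is +oo when no such T exists. *)
Definition settling_time (R : realType) (n : nat)
    (f : 'rV[R]_n -> 'rV[R]_n) (x0 : 'rV[R]_n) : \bar R :=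
  ereal_inf [set T%:E | T in [set T : R | 0 <= T /\ vanishes_after f x0 T]].

Definition fixed_time_stable (R : realType) (n : nat)
    (f : 'rV[R]_n -> 'rV[R]_n) : Prop :=
  globally_finite_time_stable f /\
  exists2 Tmax : R, 0 < Tmax &
    forall x0 : 'rV[R]_n, (settling_time f x0 <= Tmax%:E)%E.

Definition predefined_time_stable (R : realType) (n : nat)
    (f : 'rV[R]_n -> 'rV[R]_n) (Tc : R) : Prop :=
  [/\ 0 < Tc, fixed_time_stable f &
      forall x0 : 'rV[R]_n, (settling_time f x0 <= Tc%:E)%E].

Definition strong_predefined_time (R : realType) (n : nat)
    (f : 'rV[R]_n -> 'rV[R]_n) (Tc : R) : Prop :=
  predefined_time_stable f Tc /\
  ereal_sup [set settling_time f x0 | x0 in [set: 'rV[R]_n]] = Tc%:E.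

Definition positive_definite (R : realType) (n : nat)
    (V : 'rV[R]_n -> R) : Prop :=
  V 0 = 0 /\ forall x, x != 0 -> 0 < V x.

Definition radially_unbounded (R : realType) (n : nat)
    (V : 'rV[R]_n -> R) : Prop :=
  forall M : R, exists r : R, forall x, r <= `|x| -> M <= V x.

(* Away from the origin, t |-> V (x t) is differentiable along every solution
   x, and its derivative d at time t satisfies P d (x t). *)
Definition derivative_along_solutions (R : realType) (n : nat)
    (f : 'rV[R]_n -> 'rV[R]_n) (V : 'rV[R]_n -> R)
    (P : R -> 'rV[R]_n -> Prop) : Prop :=
  forall (x0 : 'rV[R]_n) (tau : \bar R) (x : R -> 'rV[R]_n),
    is_solution f x0 tau x ->
    forall t, time_domain tau t -> x t != 0 ->
      exists2 d : R,
        @has_deriv_in R R^o (time_domain tau) (V \o x) t d & P d (x t).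

(* Main.v *)
Require Import Defs.
From HB Require Import structures.
From mathcomp Require Import all_boot all_order all_algebra.
From mathcomp Require Import all_classical all_reals all_analysis.
From mathcomp Require Import measurable_realfun lra ring.
Set Implicit Arguments.
Unset Strict Implicit.
Unset Printing Implicit Defensive.
Import Order.TTheory GRing.Theory Num.Theory.
Import numFieldNormedType.Exports.
Local Open Scope classical_set_scope.
Local Open Scope ring_scope.

(** Separating variables in [v' = - a (alpha v^p + beta v^q)^k] leads to the
    function [G v], the integral of [(alpha w^p + beta w^q)^-k] for [w] between
    0 and [v]: along a solution, [G (V (x t))] decreases at rate at least
    [a = gamma / Tc] as long as [x t != 0].  Hence [x] reaches the origin no
    later than [G (V x0) / a], and exactly then if the differential inequality
    is an equality.  The total integral [G(+oo)] is [gamma], so these times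
    are bounded by [gamma / a = Tc]; since [V] takes arbitrarily large values,
    [Tc] is their supremum in the equality case.

    The value [gamma] comes from the second form of the Beta integral
    ([Gamma_mul], [integral_Beta_kernelE]): Tonelli's theorem and the scaling of
    Lebesgue measure turn [Gamma a * Gamma b] into [Gamma (a + b)] times the
    integral of [u^(a - 1) (1 + u)^-(a + b)].  To avoid changing variables in
    an improper integral, [settling_profile] defines [G] as an incomplete Beta
    integral composed with [v |-> (beta / alpha) v^(q - p)] and differentiates
    it by the chain rule.

    Stability also asserts that solutions exist, although [f] is only
    continuous.  Peano's theorem is proved for bounded [f], where it is global
    in time ([Peano_bounded]): explicit Euler schemes converge pointwise along
    an ultrafilter of step sizes.  For the given [f] it is applied to [f]
    composed with a retraction onto a large ball; the solution never leaves the
    ball, as [V] does not increase along it ([global_solution_exists]).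
    A solution on a bounded interval has an endpoint there, since its speed is
    bounded, and can be continued by a global solution from that endpoint
    ([solution_extension]), so maximal solutions are global.

    Since [V (x t)] is only known to be differentiable where [x t != 0],
    monotonicity comes
    from the mean value theorem on intervals without zeros ([Lyapunov_MVT])
    together with the fact that the origin absorbs every solution
    ([zero_absorbing]). *)

(** * Scaling of Lebesgue measure *)

(** The two measures agree on the half-open intervals, which determine Lebesgue
    measure. *)
Lemma lebesgue_measure_scale (R : realType) (c : R) (c0 : 0 < c) (A : set R) :
  measurable A ->
  pushforward (mscale (NngNum (ltW c0)) (@lebesgue_measure R))
    ( *%R c : _ -> measurableTypeR R) A = lebesgue_measure A.
Proof.
move=> mA.
have mphi : measurable_fun setT
    ( *%R c : measurableTypeR R -> measurableTypeR R).
  exact: mulrl_measurable.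
apply/esym/lebesgue_measure_unique => //= _ [[a b]] _ <-.
rewrite /pushforward/= /mscale/=.
have -> : *%R c @^-1` `]a, b] = `](a / c), (b / c)]%classic.
  by apply/seteqP; split => x; rewrite /= !in_itv/= ltr_pdivrMr// ler_pdivlMr// mulrC.
rewrite !lebesgue_measure_itv/= !lte_fin ltr_pM2r ?invr_gt0//.
case: ifPn => ab; last by rewrite mule0.
by rewrite -!EFinB -EFinM; congr EFin; field; rewrite gt_eqF.
Qed.

Lemma ge0_integral_scale (R : realType) (c : R) (h : R -> \bar R) : 0 < c ->
  measurable_fun [set: R] h -> (forall x, (0 <= h x)%E) ->
  (\int[lebesgue_measure]_x h x
   = c%:E * \int[lebesgue_measure]_x h (c * x)%R)%E.
Proof.
move=> c0 mh h0.
have mphi : measurable_fun setT ( *%R c : measurableTypeR R -> measurableTypeR R).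
  exact: mulrl_measurable.
transitivity (\int[pushforward (mscale (NngNum (ltW c0)) (@lebesgue_measure R))
    ( *%R c : _ -> measurableTypeR R)]_x h x)%E.
  by apply: eq_measure_integral => A mA _; exact/esym/lebesgue_measure_scale.
rewrite ge0_integral_pushforward// preimage_setT ge0_integral_mscale//.
  exact: (measurableT_comp mh mphi).
by move=> x _; exact: h0.
Qed.

(** * The Beta integral *)

(** The integrands are extended by 0 to the whole line, so that Tonelli's
    theorem applies on the full product space, without domain restrictions. *)
Definition Gamma_kernel (R : realType) (a t : R) : R :=
  if 0 < t then expR (- t) * t `^ (a - 1) else 0.

Definition Beta_kernel (R : realType) (a b u : R) : R :=
  if 0 < u then u `^ (a - 1) * (1 + u) `^ (- (a + b)) else 0.

Lemma Gamma_kernel_ge0 (R : realType) (a t : R) : 0 <= Gamma_kernel a t.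
Proof.
by rewrite /Gamma_kernel; case: ifP => // _; rewrite mulr_ge0 ?expR_ge0 ?powR_ge0.
Qed.

Lemma Beta_kernel_ge0 (R : realType) (a b u : R) : 0 <= Beta_kernel a b u.
Proof. by rewrite /Beta_kernel; case: ifP => // _; rewrite mulr_ge0 ?powR_ge0. Qed.

Lemma measurable_Gamma_kernel (R : realType) (a : R) :
  measurable_fun [set: R] (Gamma_kernel a).
Proof.
apply: measurable_fun_ifT => //; first exact: measurable_fun_ltr.
apply: measurable_funM; last exact: measurable_powR.
by apply: measurableT_comp => //; exact: measurable_oppr.
Qed.

Lemma measurable_Beta_kernel (R : realType) (a b : R) :
  measurable_fun [set: R] (Beta_kernel a b).
Proof.
apply: measurable_fun_ifT => //; first exact: measurable_fun_ltr.
apply: measurable_funM; first exact: measurable_powR.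
apply: (measurableT_comp (measurable_powR _)) => //.
exact: measurable_funD.
Qed.

Lemma GammaE (R : realType) (a : R) :
  Gamma a = fine (\int[lebesgue_measure]_t (Gamma_kernel a t)%:E).
Proof.
rewrite /Gamma /Rintegral integral_mkcond; congr fine.
apply: eq_integral => t _; rewrite patchE /Gamma_kernel mem_setE in_itv/= andbT.
by case: ifP.
Qed.

Lemma gt0_powRD (R : realType) (x r s : R) : 0 < x ->
  x `^ (r + s) = x `^ r * x `^ s.
Proof. by move=> x0; rewrite powRD// (gt_eqF x0) implybT. Qed.

(** The left-hand side is the integrand of the double integral for
    [Gamma a * Gamma b] after the substitution [s = t u], with Jacobian [t]; for
    fixed [u] it is, as a function of [t], a rescaled Gamma integrand.  The
    factor [Num.max 0 t] keeps it nonnegative on the whole plane. *)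
Lemma Gamma_kernel_mul_scale (R : realType) (a b t u : R) :
  Num.max 0 t * Gamma_kernel b t * Gamma_kernel a (t * u) =
  (1 + u) * Beta_kernel a b u * Gamma_kernel (a + b) ((1 + u) * t).
Proof.
rewrite /Gamma_kernel /Beta_kernel.
have [t0|t0] := ltP 0 t; last first.
  have [u0|u0] := ltP 0 u; last by rewrite !(mulr0, mul0r).
  by rewrite (pmulr_rgt0 _ (addr_gt0 ltr01 u0)) (ltNge 0 t) t0/= !(mulr0, mul0r).
have [u0|u0] := ltP 0 u; last first.
  by rewrite pmulr_rgt0// ltNge u0/= !(mulr0, mul0r).
have u1 : 0 < 1 + u by rewrite addr_gt0.
rewrite !mulr_gt0// (powRM _ (ltW t0) (ltW u0)) (powRM _ (ltW u1) (ltW t0)).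
rewrite (_ : - ((1 + u) * t) = - t + - (t * u)) ?expRD; last by ring.
rewrite (_ : a + b - 1 = (a - 1) + 1 + (b - 1)); last by ring.
rewrite powRN (_ : a + b = (a - 1) + 1 + (b - 1) + 1); last by ring.
rewrite !(gt0_powRD _ _ t0) !(gt0_powRD _ _ u1) !powRr1 ?ltW//.
by field; rewrite !gt_eqF ?powR_gt0.
Qed.

(** The substitution [s = t u] turns the double integral for
    [Gamma a * Gamma b] into one where Tonelli's theorem lets [t] be integrated
    first; what is left is a rescaled [Gamma (a + b)] for every [u]. *)
Lemma Gamma_mul (R : realType) (a b : R) :
  (\int[lebesgue_measure]_s (Gamma_kernel a s)%:E *
   \int[lebesgue_measure]_t (Gamma_kernel b t)%:E =
   \int[lebesgue_measure]_u (Beta_kernel a b u)%:E *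
   \int[lebesgue_measure]_t (Gamma_kernel (a + b) t)%:E)%E.
Proof.
have mG (c : R) := measurable_Gamma_kernel c.
have I0 (c : R) : (0 <= \int[lebesgue_measure]_t (Gamma_kernel c t)%:E)%E.
  by apply: integral_ge0 => t _; rewrite lee_fin Gamma_kernel_ge0.
pose F (z : R * R) : \bar R :=
  (Num.max 0 z.1 * Gamma_kernel b z.1 * Gamma_kernel a (z.1 * z.2))%:E.
have F0 z : (0 <= F z)%E.
  by rewrite lee_fin !mulr_ge0 ?Gamma_kernel_ge0// le_max lexx.
have mF : measurable_fun [set: R * R] F.
  apply/measurable_EFinP; apply: measurable_funM; last first.
    apply: (measurableT_comp (mG a)).
    by apply: measurable_funM; [exact: measurable_fst|exact: measurable_snd].
  apply: measurable_funM; last exact: (measurableT_comp (mG b) measurable_fst).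
  by apply: measurable_maxr => //; exact: measurable_fst.
transitivity (\int[lebesgue_measure]_t \int[lebesgue_measure]_u F (t, u))%E.
  rewrite -ge0_integralZl//; last 2 first.
  - by apply/measurable_EFinP; exact: mG.
  - by move=> t _; rewrite lee_fin Gamma_kernel_ge0.
  apply: eq_integral => t _; rewrite /F /=.
  have [t0|t0] := ltP 0 t; last first.
    rewrite /(Gamma_kernel b t) ltNge t0/= mule0.
    by under eq_integral do rewrite mulr0 mul0r; rewrite integral0.
  have -> : (\int[lebesgue_measure]_u
      (t * Gamma_kernel b t * Gamma_kernel a (t * u))%:E =
    \int[lebesgue_measure]_u
      ((t * Gamma_kernel b t)%:E * (Gamma_kernel a (t * u)%R)%:E))%E.
    by apply: eq_integral => u _.
  rewrite ge0_integralZl//; last 3 first.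
  - by apply/measurable_EFinP; exact: measurableT_comp.
  - by move=> u _; rewrite lee_fin Gamma_kernel_ge0.
  - by rewrite lee_fin mulr_ge0 ?Gamma_kernel_ge0// ltW.
  rewrite (ge0_integral_scale t0)//; last 2 first.
  - by apply/measurable_EFinP; exact: mG.
  - by move=> u; rewrite lee_fin Gamma_kernel_ge0.
  by rewrite EFinM muleAC.
transitivity (\int[lebesgue_measure]_u \int[lebesgue_measure]_t F (t, u))%E.
  exact: (@fubini_tonelli _ _ (measurableTypeR R) (measurableTypeR R) R
    lebesgue_measure lebesgue_measure F mF F0).
rewrite -ge0_integralZr//; last 2 first.
- by apply/measurable_EFinP; exact: measurable_Beta_kernel.
- by move=> u _; rewrite lee_fin Beta_kernel_ge0.
apply: eq_integral => u _; rewrite /F /=.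
have [u0|u0] := leP u 0.
  rewrite /Beta_kernel ltNge u0/= mul0e.
  rewrite [LHS](_ : _ = \int[lebesgue_measure]_t 0)%E; first by rewrite integral0.
  apply: eq_integral => t _; rewrite Gamma_kernel_mul_scale.
  by rewrite /Beta_kernel ltNge u0/= mulr0 mul0r.
have u1 : 0 < 1 + u by rewrite addr_gt0.
rewrite (@ge0_integral_scale _ _ (EFin \o Gamma_kernel (a + b)) u1)//; last 2 first.
- by apply/measurable_EFinP; exact: mG.
- by move=> t; rewrite lee_fin Gamma_kernel_ge0.
rewrite muleA -EFinM -ge0_integralZl//; last 3 first.
- by apply/measurable_EFinP; apply: (measurableT_comp (mG _)); exact: mulrl_measurable.
- by move=> t _; rewrite lee_fin Gamma_kernel_ge0.
- by rewrite lee_fin mulr_ge0 ?Beta_kernel_ge0// ltW.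
apply: eq_integral => t _.
by rewrite -EFinM Gamma_kernel_mul_scale (mulrC (1 + u)).
Qed.

Lemma powR_continuous_at (R : realType) (a x : R) : 0 < x ->
  {for x, continuous (@powR R ^~ a)}.
Proof.
move=> x0; apply: differentiable_continuous; apply/derivable1_diffP.
by apply: derivable_powR; rewrite in_itv/= x0.
Qed.

Lemma Beta_kernel_continuous_at (R : realType) (a b x : R) : 0 < x ->
  {for x, continuous (Beta_kernel a b)}.
Proof.
move=> x0.
have E : Beta_kernel a b x = x `^ (a - 1) * (1 + x) `^ (- (a + b)).
  by rewrite /Beta_kernel x0.
rewrite /prop_for /continuous_at E.
suff : (fun u => u `^ (a - 1) * (1 + u) `^ (- (a + b))) u @[u --> x] -->
    x `^ (a - 1) * (1 + x) `^ (- (a + b)).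
  apply: cvg_trans; apply: near_eq_cvg; near=> u.
  by rewrite /Beta_kernel ifT//; near: u; exact: lt_nbhsr.
apply: cvgM; first exact: powR_continuous_at.
apply: (@cvg_comp _ _ _ (fun u => 1 + u) (@powR R ^~ (- (a + b)))); last first.
  by apply: powR_continuous_at; rewrite addr_gt0.
by apply: cvgD; [exact: cvg_cst|exact: cvg_id].
Unshelve. all: by end_near. Qed.

(** [Beta_kernel a 1] is the derivative of the bounded function
    [(u / (1 + u)) ^ a / a]. *)
Lemma integral_Beta_kernel_le (R : realType) (a : R) : 0 < a ->
  (\int[lebesgue_measure]_u (Beta_kernel a 1 u)%:E <= (a^-1)%:E)%E.
Proof.
move=> a0.
pose F (u : R) := a^-1 * (u `^ a * (1 + u) `^ (- a)).
have dF (u : R) : 0 < u -> is_derive u 1 F (Beta_kernel a 1 u).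
  move=> u0; have u1 : 0 < 1 + u by rewrite addr_gt0.
  have d1 : is_derive u 1 (fun v : R => 1 + v) 1.
    by have := is_deriveD (is_derive_cst (1 : R) u 1) (is_derive_id u 1);
      rewrite add0r.
  have d2 : is_derive u 1 ((@powR R ^~ (- a)) \o (fun v : R => 1 + v))
    (- a * (1 + u) `^ (- a - 1) * 1).
    by apply: is_derive1_comp; exact: is_derive1_powR.
  have d3 : is_derive u 1 (fun v : R => v `^ a * (1 + v) `^ (- a))
    (u `^ a *: (- a * (1 + u) `^ (- a - 1) * 1) +
     (1 + u) `^ (- a) *: (a * u `^ (a - 1))).
    apply: is_deriveM; exact: is_derive1_powR.
  have : is_derive u 1 F (a^-1 *: (u `^ a *: (- a * (1 + u) `^ (- a - 1) * 1) +
      (1 + u) `^ (- a) *: (a * u `^ (a - 1)))).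
    exact: is_deriveZ.
  move=> /is_derive_eq; apply.
  rewrite /Beta_kernel u0 /GRing.scale/= mulr1 opprD.
  rewrite (_ : u `^ a = u * u `^ (a - 1)); last by rewrite mulr_powRB1// ltW.
  rewrite (_ : (1 + u) `^ (- a) = (1 + u) * (1 + u) `^ (- a - 1)); last first.
    rewrite -[X in X * _](powRr1 (ltW u1)) -gt0_powRD//; congr (_ `^ _); ring.
  by field; rewrite gt_eqF.
have F01 (u : R) : 0 < u -> 0 <= F u <= a^-1.
  move=> u0; have u1 : 0 < 1 + u by rewrite addr_gt0.
  rewrite /F !mulr_ge0 ?powR_ge0 ?invr_ge0 ?(ltW a0)//=.
  rewrite -[leRHS]mulr1 ler_pM2l ?invr_gt0// powRN ler_pdivrMr ?powR_gt0// mul1r.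
  by apply: ge0_ler_powR; rewrite ?nnegrE ?ltW// ltrDr.
(* A compact exhaustion of the open half-line: [Beta_kernel a 1] is unbounded
   near 0 when [a < 1]. *)
pose E (n : nat) : set R := `[n.+2%:R^-1, n.+2%:R]%classic.
have E0 n (u : R) : E n u -> 0 < u.
  by rewrite /E/= in_itv/= => /andP[+ _]; apply: lt_le_trans; rewrite invr_gt0.
have leE n : (\int[lebesgue_measure]_(u in E n) (Beta_kernel a 1 u)%:E <= (a^-1)%:E)%E.
  have n1 : 0 < (n.+2%:R^-1 : R) by rewrite invr_gt0.
  have n0 : (n.+2%:R^-1 : R) < n.+2%:R.
    by rewrite (@lt_le_trans _ _ 1)// ?ler1n// invf_lt1// ltr1n.
  have cF (u : R) : 0 < u -> {for u, continuous F}.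
    move=> u0; apply: differentiable_continuous; apply/derivable1_diffP.
    by have [] := dF _ u0.
  rewrite /E (@continuous_FTC2 _ _ F)//; last 3 first.
  - apply: continuous_in_subspaceT => u /set_mem uE.
    by apply: Beta_kernel_continuous_at; exact: E0 uE.
  - split.
    + move=> u; rewrite in_itv/= => /andP[nu _].
      by have [] := dF u (lt_trans n1 nu).
    + by apply: cvg_at_right_filter; apply: cF; rewrite invr_gt0.
    + by apply: cvg_at_left_filter; apply: cF.
  - move=> u; rewrite in_itv/= => /andP[nu _].
    by rewrite derive1E; have [_ ->] := dF u (lt_trans n1 nu).
  rewrite -EFinB lee_fin.
  have /andP[F0 _] := F01 _ n1.
  have /andP[_ F1] := F01 _ (lt_trans n1 n0).
  by rewrite (le_trans _ F1)// gerBl.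
have UE : \bigcup_n E n = `]0, +oo[%classic.
  apply/seteqP; split => [u [n _ /E0 u0]|u]; first by rewrite /= in_itv/= u0.
  rewrite /= in_itv/= andbT => u0.
  exists (Num.truncn (Num.max u u^-1)) => //; rewrite /E/= in_itv/=.
  have := truncnS_gt (Num.max u u^-1); rewrite gt_max => /andP[h1 h2].
  have n2 : (Num.truncn (Num.max u u^-1)).+1%:R <=
      (Num.truncn (Num.max u u^-1)).+2%:R :> R by rewrite ler_nat.
  by rewrite (le_trans (ltW h1))// andbT invf_ple ?posrE// (le_trans (ltW h2)).
have -> : (\int[lebesgue_measure]_u (Beta_kernel a 1 u)%:E =
    \int[lebesgue_measure]_(u in \bigcup_n E n) (Beta_kernel a 1 u)%:E)%E.
  rewrite UE [RHS]integral_mkcond; apply: eq_integral => u _.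
  rewrite patchE mem_setE in_itv/= andbT /Beta_kernel.
  by case: ifP.
have mB : measurable_fun [set: R] (EFin \o Beta_kernel a 1).
  by apply/measurable_EFinP; exact: measurable_Beta_kernel.
have cE : (\int[lebesgue_measure]_(u in E n) (Beta_kernel a 1 u)%:E @[n --> \oo] -->
    \int[lebesgue_measure]_(u in \bigcup_n E n) (Beta_kernel a 1 u)%:E)%E.
  apply: ge0_nondecreasing_set_cvg_integral.
  - apply/nondecreasing_seqP => n; rewrite subsetEset => u; rewrite /E/= !in_itv/=.
    move=> /andP[nu un]; rewrite (le_trans _ nu) ?(le_trans un) ?ler_nat//.
    by rewrite lef_pV2 ?posrE// ler_nat.
  - by move=> n; exact: measurable_itv.
  - by move=> n; apply: measurable_funS mB.
  - by move=> n u _; rewrite lee_fin Beta_kernel_ge0.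
rewrite -(cvg_lim _ cE)//.
by apply: lime_le; [apply/cvg_ex; eexists; exact: cE|near=> n; exact: leE].
Unshelve. all: by end_near. Qed.

(** The logarithm lies below its tangent at [a + 1]. *)
Lemma expRN_le_powR (R : realType) (a t : R) : 0 < a -> 0 < t ->
  expR (- t) <= expR (- a + (a + 1) * ln (a + 1)) * (1 + t) `^ (- (a + 1)).
Proof.
move=> a0 t0; have a1 : 0 < a + 1 by rewrite addr_gt0.
have t1 : 0 < 1 + t by rewrite addr_gt0.
rewrite /powR gt_eqF// -expRD ler_expR.
have : ln (1 + ((1 + t) / (a + 1) - 1)) <= (1 + t) / (a + 1) - 1.
  by apply: le_ln1Dx; rewrite ltrBDl subrr divr_gt0.
rewrite [1 + _]addrC subrK ln_div ?posrE// -(ler_pM2r a1) !mulrBl divfK ?gt_eqF//.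
lra.
Qed.

(** By [expRN_le_powR] the Gamma integrand is at most a constant times
    [Beta_kernel a 1], whose integral is known explicitly. *)
Lemma Gamma_kernel_integral_fin (R : realType) (a : R) : 0 < a ->
  (\int[lebesgue_measure]_t (Gamma_kernel a t)%:E < +oo)%E.
Proof.
move=> a0; pose C := expR (- a + (a + 1) * ln (a + 1)).
have C0 : 0 <= C by exact: expR_ge0.
apply: (@le_lt_trans _ _ (C%:E * (a^-1)%:E)%E); last by rewrite -EFinM ltry.
apply: le_trans (lee_wpmul2l _ (integral_Beta_kernel_le a0)); last by rewrite lee_fin.
have mB := @measurable_Beta_kernel R a 1.
rewrite -ge0_integralZl//; last 2 first.
- by apply/measurable_EFinP; exact: mB.
- by move=> u _; rewrite lee_fin Beta_kernel_ge0.
apply: ge0_le_integral => //.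
- by move=> t _; rewrite lee_fin Gamma_kernel_ge0.
- by apply/measurable_EFinP; exact: measurable_Gamma_kernel.
- by apply/measurable_EFinP; apply: measurable_funM => //; exact: mB.
- move=> t _; rewrite -EFinM lee_fin /Gamma_kernel /Beta_kernel.
  have [t0|_] := ltP 0 t; last by rewrite mulr0.
  rewrite mulrCA mulrC ler_wpM2l ?powR_ge0//.
  exact: expRN_le_powR.
Qed.

(** On [[1, 2]] the integrand is at least [expR (- 2) / 2]. *)
Lemma Gamma_kernel_integral_gt0 (R : realType) (a : R) : 0 < a ->
  (0 < \int[lebesgue_measure]_t (Gamma_kernel a t)%:E)%E.
Proof.
move=> a0; have mG : measurable_fun [set: R] (EFin \o Gamma_kernel a).
  by apply/measurable_EFinP; exact: measurable_Gamma_kernel.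
apply: (@lt_le_trans _ _
    (\int[lebesgue_measure]_(t in `[1%R, 2%R]) (Gamma_kernel a t)%:E)%E); last first.
  apply: ge0_subset_integral => //.
  by move=> t _; rewrite lee_fin Gamma_kernel_ge0.
apply: (@lt_le_trans _ _
    (\int[lebesgue_measure]_(t in `[1%R, 2%R]) (expR (- 2) / 2)%:E)%E).
  rewrite integral_cst//= lebesgue_measure_itv/= lte_fin ltr1n/=.
  by rewrite -EFinD -EFinM lte_fin mulr_gt0 ?divr_gt0 ?expR_gt0//; lra.
have half (s : R) : 1 <= s -> s <= 2 -> 2^-1 <= s `^ (a - 1).
  move=> s1 s2; have s0 : 0 <= s by rewrite (le_trans _ s1).
  have sa : 1 <= s * s `^ (a - 1).
    by rewrite mulr_powRB1// -(powRr0 s) ler_powR// ltW.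
  rewrite -[2^-1]mul1r ler_pdivrMr// (le_trans sa)// mulrC.
  by rewrite ler_wpM2l ?powR_ge0.
apply: ge0_le_integral => //.
- exact: measurable_funS mG.
- move=> t /=; rewrite in_itv/= => /andP[t1 t2].
  have t0 : 0 < t by rewrite (lt_le_trans _ t1).
  rewrite lee_fin /Gamma_kernel t0 ler_pM ?expR_ge0// ?ler_expR ?lerN2//.
  exact: half.
Qed.

Lemma Gamma_gt0 (R : realType) (a : R) : 0 < a -> 0 < Gamma a.
Proof.
move=> a0; rewrite GammaE fine_gt0// Gamma_kernel_integral_gt0//=.
exact: Gamma_kernel_integral_fin.
Qed.

(** The identity [Gamma_mul] is between extended reals; dividing by
    [Gamma (a + b)] requires it to be finite and nonzero. *)
Lemma integral_Beta_kernelE (R : realType) (a b : R) : 0 < a -> 0 < b ->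
  (\int[lebesgue_measure]_u (Beta_kernel a b u)%:E =
   (Gamma a * Gamma b / Gamma (a + b))%:E)%E.
Proof.
move=> a0 b0.
have fE (c : R) : 0 < c ->
    (\int[lebesgue_measure]_t (Gamma_kernel c t)%:E = (Gamma c)%:E)%E.
  move=> c0; rewrite GammaE fineK// ge0_fin_numE ?Gamma_kernel_integral_fin//.
  exact/ltW/Gamma_kernel_integral_gt0.
have ab0 : 0 < a + b by rewrite addr_gt0.
have := Gamma_mul a b; rewrite !fE//.
have : (0 <= \int[lebesgue_measure]_u (Beta_kernel a b u)%:E)%E.
  by apply: integral_ge0 => u _; rewrite lee_fin Beta_kernel_ge0.
case: (\int[lebesgue_measure]_u _)%E => [r _| _|//].
  by rewrite -!EFinM => -[->]; rewrite mulfK// gt_eqF ?Gamma_gt0.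
by rewrite gt0_mulye ?lte_fin ?Gamma_gt0.
Qed.

(** * The incomplete Beta integral *)

Definition incomplete_Beta (R : realType) (a b u : R) : R :=
  \int[lebesgue_measure]_(t in `[0, u]) Beta_kernel a b t.

Lemma Beta_kernel_integrable (R : realType) (a b : R) (D : set R) :
  0 < a -> 0 < b -> measurable D ->
  lebesgue_measure.-integrable D (EFin \o Beta_kernel a b).
Proof.
move=> a0 b0 mD.
apply: (integrableS (measurableT : measurable [set: measurableTypeR R])) => //.
apply/integrableP; split.
  by apply/measurable_EFinP; exact: measurable_Beta_kernel.
rewrite [ltLHS](_ : _ = \int[lebesgue_measure]_u (Beta_kernel a b u)%:E)%E.
  by rewrite integral_Beta_kernelE// ltry.
by apply: eq_integral => u _; rewrite /= ger0_norm// Beta_kernel_ge0.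
Qed.

Section incomplete_Beta.
Context {R : realType} (a b : R) (a0 : 0 < a) (b0 : 0 < b).
Local Notation B := (incomplete_Beta a b).

Let BE u :
  ((B u)%:E = \int[lebesgue_measure]_(t in `[0%R, u]) (Beta_kernel a b t)%:E)%E.
Proof.
rewrite /incomplete_Beta /Rintegral fineK//.
by apply: integrable_fin_num => //; exact: Beta_kernel_integrable.
Qed.

Lemma incomplete_Beta0 : B 0 = 0.
Proof. by rewrite /incomplete_Beta set_itv1 Rintegral_set1. Qed.

Lemma incomplete_Beta_ge0 u : 0 <= B u.
Proof. by apply: Rintegral_ge0 => t _; exact: Beta_kernel_ge0. Qed.

Lemma is_derive_incomplete_Beta (u : R) : 0 < u -> is_derive u 1 B (Beta_kernel a b u).
Proof.
move=> u0.
have [dB BE'] := @continuous_FTC1_closed R (Beta_kernel a b) 0 u (u + 1)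
  ltac:(by rewrite ltrDl) (Beta_kernel_integrable a0 b0 (measurable_itv _))
  u0 (Beta_kernel_continuous_at (a := a) (b := b) u0).
by apply: DeriveDef; [exact: dB|rewrite -derive1E BE'].
Qed.

Lemma incomplete_Beta_cvg0 : B u @[u --> 0] --> 0.
Proof.
exact: (parameterized_integral_cvg_left ltr01
  (Beta_kernel_integrable a0 b0 (measurable_itv _))).
Qed.

(** The mean value theorem on [[u / 2, u]] stays away from the possible
    singularity of the integrand at 0. *)
Lemma incomplete_Beta_gt0 (u : R) : 0 < u -> 0 < B u.
Proof.
move=> u0; have u2 : 0 < u / 2 by rewrite divr_gt0.
have lt2 : u / 2 < u by lra.
have [||c] := @MVT R B (Beta_kernel a b) (u / 2) u lt2.
- move=> x; rewrite in_itv/= => /andP[x0 _].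
  exact/is_derive_incomplete_Beta/(lt_trans u2).
- apply: derivable_within_continuous => x; rewrite in_itv/= => /andP[x0 _].
  by have [] := is_derive_incomplete_Beta (lt_le_trans u2 x0).
rewrite in_itv/= => /andP[c0 _] Bu.
rewrite -[B u](subrK (B (u / 2))) Bu ltr_wpDr ?incomplete_Beta_ge0//.
have {}c0 : 0 < c by exact: lt_trans c0.
rewrite mulr_gt0 ?subr_gt0// /Beta_kernel c0 mulr_gt0 ?powR_gt0//.
by rewrite addr_gt0.
Qed.

Lemma incomplete_Beta_nd : {homo B : u v / u <= v}.
Proof.
move=> u v uv; rewrite -lee_fin !BE; apply: ge0_subset_integral => //.
- apply: measurable_funS (_ : measurable_fun [set: R] _) => //.
  by apply/measurable_EFinP; exact: measurable_Beta_kernel.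
- by move=> t _; rewrite lee_fin Beta_kernel_ge0.
- by move=> t; rewrite /= !in_itv/= => /andP[-> /le_trans]; exact.
Qed.

Lemma incomplete_Beta_le u : B u <= Gamma a * Gamma b / Gamma (a + b).
Proof.
rewrite -lee_fin BE -integral_Beta_kernelE//; apply: ge0_subset_integral => //.
- by apply/measurable_EFinP; exact: measurable_Beta_kernel.
- by move=> t _; rewrite lee_fin Beta_kernel_ge0.
Qed.

Lemma incomplete_Beta_approx T : T < Gamma a * Gamma b / Gamma (a + b) ->
  exists2 u, 0 < u & T < B u.
Proof.
move=> TB; apply/not_exists2P => H.
have {}H (n : nat) : B n.+1%:R <= T.
  by have [//|/negP] := H n.+1%:R; rewrite -leNgt.
pose E (n : nat) : set R := `[0, n.+1%:R]%classic.
have cE : (\int[lebesgue_measure]_(u in E n) (Beta_kernel a b u)%:E @[n --> \oo] -->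
    \int[lebesgue_measure]_(u in \bigcup_n E n) (Beta_kernel a b u)%:E)%E.
  apply: ge0_nondecreasing_set_cvg_integral.
  - apply/nondecreasing_seqP => n; rewrite subsetEset => u; rewrite /E/= !in_itv/=.
    by move=> /andP[-> un]; rewrite (le_trans un) ?ler_nat.
  - by move=> n; exact: measurable_itv.
  - move=> n; apply: measurable_funS (_ : measurable_fun [set: R] _) => //.
    by apply/measurable_EFinP; exact: measurable_Beta_kernel.
  - by move=> n u _; rewrite lee_fin Beta_kernel_ge0.
have : (\int[lebesgue_measure]_(u in \bigcup_n E n) (Beta_kernel a b u)%:E <= T%:E)%E.
  rewrite -(cvg_lim _ cE)//.
  apply: lime_le; first by apply/cvg_ex; eexists; exact: cE.
  by near=> n; rewrite /E -BE lee_fin.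
have -> : (\int[lebesgue_measure]_(u in \bigcup_n E n) (Beta_kernel a b u)%:E =
    \int[lebesgue_measure]_u (Beta_kernel a b u)%:E)%E.
  rewrite integral_mkcond; apply: eq_integral => u _.
  rewrite patchE; case: ifPn => // /negP uE; rewrite /Beta_kernel.
  case: ltP => // u0; exfalso; apply: uE; rewrite inE.
  exists (Num.truncn u) => //; rewrite /E/= in_itv/= (ltW u0)/=.
  exact/ltW/truncnS_gt.
by rewrite integral_Beta_kernelE// lee_fin leNgt TB.
Unshelve. all: by end_near. Qed.

End incomplete_Beta.

(** * The time to the origin as a function of the level of V *)

(** [G v] is the time that the scalar equation [v' = - (alpha v^p + beta v^q)^k]
    needs from level [v] down to 0, and [gamma] is its supremum, approached at
    large levels.  The substitution [u = (beta / alpha) v^(q - p)] reduces it to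
    an incomplete Beta integral with exponents [mp] and [mq], whose sum is
    [k]. *)
Lemma settling_profile (R : realType) (alpha beta p q k : R) :
  0 < alpha -> 0 < beta -> 0 < k -> k * p < 1 -> 1 < k * q ->
  let mp : R := (1 - k * p) / (q - p) in
  let mq := (k * q - 1) / (q - p) in
  let gamma := Gamma mp * Gamma mq / (alpha `^ k * Gamma k * (q - p))
               * (alpha / beta) `^ mp in
  exists G : R -> R,
    [/\ G 0 = 0,
        forall v : R, 0 < v ->
          is_derive v 1 G ((alpha * v `^ p + beta * v `^ q) `^ k)^-1,
        forall v : R, 0 < v -> 0 < G v,
        forall eps : R, 0 < eps ->
          exists2 d : R, 0 < d & forall v : R, 0 < v < d -> G v < eps &
        (forall v : R, G v <= gamma) /\
        (forall T : R, T < gamma ->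
          exists2 v0 : R, 0 < v0 & forall v : R, v0 <= v -> T < G v)].
Proof.
move=> alpha0 beta0 k0 kp kq mp mq gamma.
have pq : 0 < q - p by rewrite subr_gt0 -(ltr_pM2l k0) (lt_trans kp).
have mp0 : 0 < mp by rewrite divr_gt0 // subr_gt0.
have mq0 : 0 < mq by rewrite divr_gt0 // subr_gt0.
have mpq : mp + mq = k by rewrite /mp /mq; field; rewrite gt_eqF.
pose c := beta / alpha; have c0 : 0 < c by rewrite divr_gt0.
pose K := (alpha / beta) `^ mp / (alpha `^ k * (q - p)).
have K0 : 0 < K by rewrite !(divr_gt0, mulr_gt0, powR_gt0).
pose U (v : R) := c * v `^ (q - p).
have U0 (v : R) : 0 < v -> 0 < U v by move=> v0; rewrite mulr_gt0 ?powR_gt0.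
have gammaE : gamma = K * (Gamma mp * Gamma mq / Gamma (mp + mq)).
  rewrite mpq /gamma /K; field.
  by rewrite !gt_eqF ?Gamma_gt0 ?powR_gt0.
pose B := incomplete_Beta mp mq.
exists (fun v : R => K * B (U v)); split.
- by rewrite /U powR0 ?gt_eqF// mulr0 /B incomplete_Beta0 mulr0.
- move=> v v0.
  have dU : is_derive v 1 U (c *: ((q - p) * v `^ (q - p - 1))).
    by apply: is_deriveZ; exact: is_derive1_powR.
  have dB : is_derive v 1 (B \o U)
      (Beta_kernel mp mq (U v) * (c *: ((q - p) * v `^ (q - p - 1)))).
    by apply: is_derive1_comp; apply: is_derive_incomplete_Beta => //; exact: U0.
  have : is_derive v 1 (fun v : R => K * B (U v))
      (K *: (Beta_kernel mp mq (U v) * (c *: ((q - p) * v `^ (q - p - 1))))).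
    exact: is_deriveZ.
  move=> /is_derive_eq; apply; rewrite /GRing.scale/=.
  have U1 : 0 < 1 + U v by rewrite addr_gt0 ?U0.
  have -> : alpha * v `^ p + beta * v `^ q = alpha * v `^ p * (1 + U v).
    rewrite [X in beta * v `^ X](_ : q = p + (q - p)); last by ring.
    rewrite gt0_powRD// /U /c.
    by field; rewrite gt_eqF.
  rewrite /Beta_kernel U0// mpq.
  have vE : (v `^ p) `^ k = v `^ (p * k) by rewrite powRrM.
  have UE : U v `^ (mp - 1) = c `^ (mp - 1) / (v `^ (p * k) * v `^ (q - p - 1)).
    rewrite /U powRM ?powR_ge0 ?(ltW c0)// -powRrM -gt0_powRD// -powRN.
    by congr (_ * _ `^ _); rewrite /mp; field; rewrite gt_eqF.
  have KE : K = (c * c `^ (mp - 1))^-1 / (alpha `^ k * (q - p)).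
    rewrite mulr_powRB1 ?(ltW c0)// -powRN -mulN1r powRrM powR_inv1 ?(ltW c0)//.
    by rewrite /c invf_div.
  rewrite UE KE powRN (powRM k (mulr_ge0 (ltW alpha0) (powR_ge0 v p)) (ltW U1)).
  rewrite (powRM k (ltW alpha0) (powR_ge0 v p)) vE.
  by field; rewrite !gt_eqF ?powR_gt0.
- by move=> v v0; rewrite mulr_gt0// incomplete_Beta_gt0// U0.
- move=> eps eps0.
  have /cvgrPdist_lt /(_ (eps / K)) := incomplete_Beta_cvg0 mp0 mq0.
  rewrite divr_gt0// => /(_ erefl) [d /= d0 dB].
  exists ((d / c) `^ (q - p)^-1); first by rewrite powR_gt0 ?divr_gt0.
  move=> v /andP[v0 vd]; rewrite -ltr_pdivlMl// mulrC.
  have Ud : U v < d.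
    rewrite /U -ltr_pdivlMl// mulrC.
    have := @gt0_ltr_powR R (q - p) pq v ((d / c) `^ (q - p)^-1).
    rewrite !nnegrE powR_ge0 (ltW v0) => /(_ erefl erefl vd).
    by rewrite -powRrM mulVf ?gt_eqF// powRr1// divr_ge0// ltW.
  have := dB (U v); rewrite /ball_/= sub0r normrN gtr0_norm ?U0// => /(_ Ud).
  by rewrite sub0r normrN ger0_norm// incomplete_Beta_ge0.
- split=> [v|T]; first by rewrite gammaE ler_pM2l// incomplete_Beta_le.
  rewrite gammaE -ltr_pdivrMl// => /(incomplete_Beta_approx mp0 mq0)[u u0 Tu].
  exists ((u / c) `^ (q - p)^-1); first by rewrite powR_gt0 ?divr_gt0.
  move=> v uv; rewrite -ltr_pdivrMl// (lt_le_trans Tu)// incomplete_Beta_nd//.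
  rewrite /U -ler_pdivrMl// mulrC.
  have := @ge0_ler_powR R (q - p) (ltW pq) ((u / c) `^ (q - p)^-1) v.
  have v0 : 0 <= v by rewrite (le_trans _ uv) ?powR_ge0.
  rewrite !nnegrE powR_ge0 v0 => /(_ erefl erefl uv).
  by rewrite -powRrM mulVf ?gt_eqF// powRr1// divr_ge0// ltW.
Qed.

(** * Peano's existence theorem *)

Section explicit_Euler.
Context {R : realType} {W : normedModType R} (g : W -> W) (x0 : W) (h : R).
Hypothesis h0 : 0 <= h.

Fixpoint Euler (j : nat) : W :=
  if j is i.+1 then Euler i + h *: g (Euler i) else x0.

(** Every increment of the scheme is [h] times a value of [g]; if those values
    are within [e] of [v], so is the mean slope.  The indices are not ordered,
    because the limit has to be differentiated from both sides. *)
Lemma Euler_dist (v : W) (e : R) (i j : nat) :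
  (forall l, (minn i j <= l < maxn i j)%N -> `|g (Euler l) - v| <= e) ->
  `|Euler j - Euler i - ((j%:R - i%:R) * h) *: v| <= `|j%:R - i%:R| * h * e.
Proof.
wlog ij : i j / (i <= j)%N => [H|].
  have [/H//|ji] := orP (leq_total i j).
  move=> K; have := H _ _ ji; rewrite minnC maxnC => /(_ K).
  rewrite (distrC i%:R) -normrN; congr (`|_| <= _).
  by rewrite opprB (opprB (Euler i)) addrC -scaleNr -mulNr opprB.
rewrite (minn_idPl ij) (maxn_idPr ij) -natrB// normr_nat.
elim: j ij => [|j IH].
  by rewrite leqn0 => /eqP -> _; rewrite subnn !mul0r scale0r subrr subr0 normr0.
rewrite leq_eqVlt => /predU1P[<- _|].
  by rewrite subnn !mul0r scale0r subrr subr0 normr0.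
rewrite ltnS => ij K.
have /IH {}IH := ij.
rewrite subSn// -natr1 !mulrDl !mul1r scalerDl /=.
rewrite (_ : _ - _ = (Euler j - Euler i - ((j - i)%:R * h) *: v) +
    h *: (g (Euler j) - v)); last first.
  rewrite scalerBr addrACA -opprD; congr (_ - _).
  by rewrite addrAC.
apply: le_trans (ler_normD _ _) _; apply: lerD.
  by apply: IH => l /andP[il lj]; apply: K; rewrite il/= leqW.
by rewrite normrZ ger0_norm// ler_wpM2l// K// ij/=.
Qed.

End explicit_Euler.

(** Along an ultrafilter a cluster point is a limit. *)
Lemma ultra_cvg_compact (I : Type) (T : topologicalType) (U : set_system I)
    (u : I -> T) (K : set T) :
  UltraFilter U -> compact K -> (\forall i \near U, K (u i)) ->
  exists l : T, u @ U --> l.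
Proof.
move=> UU cK uK; have PU : ProperFilter (u @ U) by exact: fmap_proper_filter.
have [l [_ ul]] : K `&` cluster (u @ U) !=set0.
  exact: cK.
exists l => A lA; have [//|UA] := in_ultra_setVsetC (u @^-1` A) UU.
by have [y []] := ul (~` A) A UA lA.
Qed.

Lemma compact_norm_ball (R : realType) (W : normedModType R) :
  (forall A : set W, bounded_set A -> closed A -> compact A) ->
  forall (c : W) (r : R), compact [set y : W | `|y - c| <= r].
Proof.
move=> compactW c r; apply: compactW.
  exists (`|c| + r); split; first exact: num_real.
  move=> m rm y /= yr; rewrite -[y](subrK c) (le_trans (ler_normD _ _))//.
  by rewrite (le_trans _ (ltW rm))// addrC lerD2l.
have -> : [set y : W | `|y - c| <= r] = closed_ball_ Num.norm c r.
  by apply/seteqP; split => y /=; rewrite /closed_ball_/= distrC.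
exact: closed_closed_ball_.
Qed.

Section Peano.
Context {R : realType} {W : normedModType R} (g : W -> W) (x0 : W) (M : R).
Hypothesis compactW : forall A : set W, bounded_set A -> closed A -> compact A.
Hypothesis cg : continuous g.
Hypothesis gM : forall y, `|g y| <= M.

Let h (N : nat) : R := N.+1%:R^-1.
Let h0 N : 0 < h N. Proof. by rewrite invr_gt0. Qed.
Let X (N : nat) (t : R) : W := Euler g x0 (h N) (Num.truncn (t / h N)).

Let M0 : 0 <= M. Proof. exact: le_trans (gM 0). Qed.

Let truncn_scaled N t : 0 <= t ->
  (Num.truncn (t / h N))%:R * h N <= t < (Num.truncn (t / h N))%:R * h N + h N.
Proof.
move=> t0; have t1 : 0 <= t / h N by rewrite divr_ge0 ?(ltW (h0 N)).
have /andP[a1 a2] := truncn_itv t1.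
rewrite -ler_pdivlMr// a1/= -[X in _ + X]mul1r -mulrDl -ltr_pdivrMr//.
by rewrite natr1.
Qed.

Let index_dist N s t : 0 <= s -> 0 <= t ->
  `|((Num.truncn (s / h N))%:R - (Num.truncn (t / h N))%:R) * h N - (s - t)|
  <= h N.
Proof.
move=> /(truncn_scaled N)/andP[s1 s2] /(truncn_scaled N)/andP[t1 t2].
by rewrite mulrBl ler_norml; apply/andP; split; lra.
Qed.

(* The Euler scheme read as a step function of time satisfies, up to an error
   of the order of the step [h N], the estimate that defines the derivative. *)
Let X_dist N (v : W) (e s t : R) : 0 <= s -> 0 <= t -> 0 <= e ->
  (forall y, `|y - X N t| <= (`|s - t| + h N) * M -> `|g y - v| <= e) ->
  `|X N s - X N t - (s - t) *: v| <= (`|s - t| + h N) * e + h N * `|v|.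
Proof.
move=> s0 t0 e0 K; have st := index_dist N s0 t0.
set j := Num.truncn (s / h N) in st; set i := Num.truncn (t / h N) in st.
have ij : `|j%:R - i%:R| * h N <= `|s - t| + h N.
  rewrite -[X in _ * X](ger0_norm (ltW (h0 N))) -normrM.
  rewrite -[X in `|X|](subrK (s - t)) addrC.
  exact: le_trans (ler_normD _ _) (lerD _ st).
rewrite -[X in `|X|](subrK (((j%:R - i%:R) * h N - (s - t)) *: v)).
apply: le_trans (ler_normD _ _) _; apply: lerD; last first.
  by rewrite normrZ ler_wpM2r.
rewrite (scalerBl (_ * h N) (s - t)) (opprB (_ * h N *: v)) subrKA.
apply: le_trans (Euler_dist (ltW (h0 N)) (e := e) _) _; last exact: ler_wpM2r.
move=> l /andP[l1 l2]; apply: K.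
have := @Euler_dist _ _ g x0 _ (ltW (h0 N)) 0 M i l.
rewrite scaler0 subr0 => H.
apply: le_trans (H _) _; first by move=> m _; rewrite subr0.
rewrite ler_wpM2r// (le_trans _ ij)// ler_wpM2r ?(ltW (h0 N))//.
have [ij'|ij'] := leqP i j.
- rewrite ger0_norm ?subr_ge0 ?ler_nat; last by move: l1; rewrite (minn_idPl ij').
  rewrite ger0_norm ?subr_ge0 ?ler_nat// lerD2r ler_nat.
  by move: l2; rewrite (maxn_idPr ij') => /ltnW.
- have ji := ltnW ij'; rewrite distrC (distrC j%:R).
  rewrite ger0_norm ?subr_ge0 ?ler_nat; last first.
    by move: l2; rewrite (maxn_idPl ji) => /ltnW.
  rewrite ger0_norm ?subr_ge0 ?ler_nat// lerD2l lerN2 ler_nat.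
  by move: l1; rewrite (minn_idPr ji).
Qed.

(** An ultrafilter makes all the sequences [X N t] converge at once, without
    extracting subsequences.  The estimate [X_dist] at a fixed pair of times
    involves the continuity of [g] at the limit point [x t] only, with a radius
    independent of [N], so it passes to the limit. *)
Lemma Peano_bounded : exists x : R -> W, x 0 = x0 /\
  forall t eps : R, 0 <= t -> 0 < eps -> exists2 d : R, 0 < d &
    forall s : R, 0 <= s -> `|s - t| < d ->
      `|x s - x t - (s - t) *: g (x t)| <= eps * `|s - t|.
Proof.
have [U [UU oU]] := ultraFilterLemma eventually_filter.
have X0 N : X N 0 = x0 by rewrite /X mul0r truncn0.
have XM N t : 0 <= t -> `|X N t - x0| <= (t + 1) * M.
  move=> t0; have := @X_dist N 0 M t 0 t0 (lexx _) M0.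
  rewrite X0 scaler0 !subr0 normr0 mulr0 addr0 ger0_norm// => H.
  apply: le_trans (H _) _; first by move=> y _; rewrite subr0.
  by rewrite ler_wpM2r// lerD2l invf_le1// ler1n.
have PU : ProperFilter U by exact: ultra_proper.
have cvgX t : exists l : W, 0 <= t -> X N t @[N --> U] --> l.
  have [t0|_] := leP 0 t; last by exists 0.
  have XK : \forall N \near U, `|X N t - x0| <= (t + 1) * M.
    by apply: nearW => N; exact: XM.
  have [l Xl] := ultra_cvg_compact UU
    (@compact_norm_ball _ _ compactW x0 ((t + 1) * M)) XK.
  by exists l.
have [x xP] := choice cvgX.
exists x; split.
  have := xP 0 (lexx _); rewrite (_ : (fun N => X N 0) = cst x0); last exact/funext.
  by move=> /cvg_lim <-//; rewrite lim_cst.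
move=> t eps t0 eps0.
have M1 : 0 < M + 1 by rewrite ltr_wpDl.
have /cvgrPdist_le/(_ _ eps0)/nbhs_ballP[rho /= rho0 grho] := @cg (x t).
(* Within this time the scheme, of speed at most [M], moves by less than
   [rho / 2]; the other half is left for the distance to the limit. *)
exists (rho / 2 / (M + 1)); first by rewrite !divr_gt0.
move=> s s0; rewrite ltr_pdivlMr// => st.
apply/ler_addgt0Pr => e e0.
pose c := 2 + eps + `|g (x t)|.
have c0 : 0 < c by rewrite ltr_wpDr// addr_gt0.
pose eta := Num.min (rho / 2 / (M + 1)) (e / c).
have eta0 : 0 < eta by rewrite lt_min !divr_gt0.
have eta1 : eta * (M + 1) <= rho / 2 by rewrite -ler_pdivlMr// ge_min lexx.
have eta2 : eta * c <= e by rewrite -ler_pdivlMr// ge_min lexx orbT.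
have hU : \forall N \near U, h N < eta.
  apply: oU; have [N _ HN] := near_infty_natSinv_lt (PosNum eta0).
  by exists N.
have /cvgrPdist_le/(_ _ eta0) sU := xP s s0.
have /cvgrPdist_le/(_ _ eta0) tU := xP t t0.
have [N [[hN sN] tN]] := filter_ex (filterI (filterI hU sU) tU).
have Xst : `|X N s - X N t - (s - t) *: g (x t)| <=
    (`|s - t| + h N) * eps + h N * `|g (x t)|.
  apply: X_dist => //; first exact: ltW.
  move=> y yX; rewrite distrC; apply: grho; rewrite -ball_normE/=.
  rewrite -[_ - _](subrKA (X N t)) (le_lt_trans (ler_normD _ _))//.
  rewrite (distrC _ y) (le_lt_trans (lerD tN yX))//.
  have hM : h N * M <= eta * M by rewrite ler_wpM2r// ltW.
  have : 0 <= `|s - t| by [].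
  lra.
have -> : x s - x t - (s - t) *: g (x t) =
    (x s - X N s) - (x t - X N t) + (X N s - X N t - (s - t) *: g (x t)).
  rewrite addrA; congr (_ - _).
  by rewrite opprB -addrA (addrC (X N t - _)) !subrKA.
apply: le_trans (ler_normD _ _) _.
apply: le_trans (lerD (ler_normB _ _) Xst) _.
apply: le_trans (lerD (lerD sN tN) (lexx _)) _.
have h1 : h N * eps <= eta * eps by rewrite ler_wpM2r ?ltW.
have h2 : h N * `|g (x t)| <= eta * `|g (x t)| by apply: ler_wpM2r => //; exact: ltW.
rewrite /c in eta2; lra.
Qed.

End Peano.

(** * One-sided derivatives and zeros of nonnegative functions *)

(** Without division, the estimate makes sense at [s = t] and passes to
    pointwise limits. *)
Lemma has_deriv_inP (R : realType) (W : normedModType R) (J : set R)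
    (g : R -> W) (t : R) (d : W) :
  has_deriv_in J g t d <->
  forall eps : R, 0 < eps -> exists2 del : R, 0 < del &
    forall s, J s -> `|s - t| < del ->
      `|g s - g t - (s - t) *: d| <= eps * `|s - t|.
Proof.
have E (s : R) : s != t -> (s - t) *: ((s - t)^-1 *: (g s - g t) - d) =
    g s - g t - (s - t) *: d.
  by move=> st; rewrite scalerBr scalerA divff ?scale1r// subr_eq0.
split=> [/cvgrPdist_le H eps eps0|H].
  have [del /= del0 K] := H _ eps0; exists del => // s Js st.
  have [->|nst] := eqVneq s t; first by rewrite !subrr scale0r subr0 !normr0 mulr0.
  rewrite -E// normrZ mulrC ler_wpM2r// distrC.
  by apply: K => //=; rewrite distrC.
apply/cvgrPdist_le => eps eps0; have [del del0 K] := H _ eps0.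
exists del => //= s st nst Js.
rewrite distrC -(@ler_pM2r _ `|s - t|) ?normr_gt0 ?subr_eq0// mulrC -normrZ E//.
by apply: K => //; rewrite distrC.
Qed.

Lemma has_deriv_in_continuous (R : realType) (W : normedModType R) (J : set R)
    (g : R -> W) (t : R) (d : W) :
  has_deriv_in J g t d -> g s @[s --> within J (nbhs t)] --> g t.
Proof.
move=> /has_deriv_inP/(_ 1 ltr01)[del del0 H].
apply/cvgrPdist_le => eps eps0.
have c0 : 0 < 1 + `|d| by rewrite ltr_wpDr.
exists (Num.min del (eps / (1 + `|d|))); first by rewrite /= lt_min del0 divr_gt0.
move=> s /=; rewrite lt_min => /andP[sd se] Js.
rewrite distrC in sd; rewrite distrC ltr_pdivlMr// in se.
rewrite distrC -[_ - _](subrK ((s - t) *: d)).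
rewrite (le_trans (ler_normD _ _))// (le_trans _ (ltW se))// mulrDr mulr1.
rewrite lerD//; last by rewrite normrZ.
by have := H s Js sd; rewrite mul1r.
Qed.

Lemma has_deriv_in_is_derive (R : realType) (J : set R) (g : R -> R) (t d : R) :
  nbhs t J -> @has_deriv_in R R^o J g t d -> is_derive t 1 g d.
Proof.
move=> nJ /has_deriv_inP H.
have cvgd : h^-1 *: (g (h *: (1 : R) + t) - g t) @[h --> 0^'] --> d.
  apply/cvgrPdist_le => eps eps0; have [del del0 K] := H _ eps0.
  have [rho /= rho0 JK] := nJ.
  exists (Num.min del rho); first by rewrite /= lt_min del0.
  move=> h /=; rewrite sub0r normrN lt_min => /andP[hd hr] h0.
  rewrite /GRing.scale/= mulr1.
  have := K (h + t); rewrite addrK => /(_ (JK _ _) hd) => K'.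
  rewrite distrC -(@ler_pM2r _ `|h|) ?normr_gt0// -normrM mulrC mulrBr mulVKf//.
  by apply: K'; rewrite /= opprD addrCA subrr addr0 normrN.
apply: DeriveDef; first by apply/cvg_ex; exists d.
exact/cvg_lim.
Qed.

Lemma time_domain_nbhs (R : realType) (tau : \bar R) (t : R) :
  0 < t -> (t%:E < tau)%E -> nbhs t (time_domain tau).
Proof.
move=> t0; case: tau => [r| _|//]; last first.
  by near=> s; split; [apply: ltW; near: s; exact: lt_nbhsr|rewrite ltry].
rewrite lte_fin => tr; near=> s; split.
  by apply: ltW; near: s; exact: lt_nbhsr.
by rewrite lte_fin; near: s; exact: lt_nbhsl.
Unshelve. all: by end_near. Qed.

Lemma time_domain_le (R : realType) (tau : \bar R) (s t : R) :
  0 <= s -> s <= t -> time_domain tau t -> time_domain tau s.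
Proof. by move=> s0 st [_ tt]; split => //; apply: le_lt_trans tt; rewrite lee_fin. Qed.

Lemma within_itv_dist (R : realType) (phi : R -> R) (s t : R) :
  {within `[s, t], continuous phi} ->
  forall u e : R, s <= u <= t -> 0 < e -> exists2 d : R, 0 < d &
    forall w, s <= w <= t -> `|w - u| < d -> `|phi w - phi u| < e.
Proof.
move=> cphi u e ust e0; have /subspace_continuousP/(_ u) := cphi.
rewrite /= in_itv/= => /(_ ust)/cvgrPdist_lt/(_ _ e0)[d /= d0 H].
exists d => // w wst wd; rewrite distrC; apply: H; rewrite /= ?in_itv//.
by rewrite distrC.
Qed.

Section zeros.
Context {R : realType} (phi : R -> R) (s t : R) (st : s <= t).
Hypothesis cphi : {within `[s, t], continuous phi}.
Hypothesis phi0 : forall u, s <= u <= t -> 0 <= phi u.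

Let near_phi := within_itv_dist cphi.

Lemma last_zero : (exists2 u, s <= u <= t & phi u = 0) ->
  exists z, [/\ s <= z <= t, phi z = 0 & forall u, z < u <= t -> 0 < phi u].
Proof.
move=> [u ust u0]; pose Z := [set u | s <= u <= t /\ phi u = 0].
have Zsup : has_sup Z.
  by split; [exists u|exists t => w [/andP[]]].
have zst : s <= sup Z <= t.
  apply/andP; split; last by apply: ge_sup; [exists u|move=> w [/andP[]]].
  have /andP[su _] := ust; apply: le_trans su _; apply: sup_upper_bound => //.
have z0 : phi (sup Z) = 0.
  apply/eqP/negPn/negP => zn0.
  have z_gt0 : 0 < phi (sup Z) by rewrite lt_neqAle eq_sym zn0 phi0.
  have [d d0 H] := near_phi zst z_gt0.
  have [w [wst w0] wz] := sup_adherent d0 Zsup.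
  have wz' : w <= sup Z by exact: sup_upper_bound.
  have := H w wst; rewrite w0 sub0r normrN (gtr0_norm z_gt0) ltxx.
  by rewrite ler0_norm ?subr_le0// opprB ltrBlDr -ltrBlDl => /(_ wz).
exists (sup Z); split => // w /andP[zw wt].
have wst : s <= w <= t by rewrite wt (le_trans _ (ltW zw)); case/andP: zst.
rewrite lt_neqAle phi0// andbT eq_sym; apply/negP => /eqP w0.
have : w <= sup Z by apply: sup_upper_bound.
by rewrite leNgt zw.
Qed.

Lemma first_zero : (exists2 u, s <= u <= t & phi u = 0) ->
  exists z, [/\ s <= z <= t, phi z = 0 & forall u, s <= u < z -> 0 < phi u].
Proof.
move=> [u ust u0]; pose Z := [set u | s <= u <= t /\ phi u = 0].
have Zinf : has_inf Z.
  by split; [exists u|exists s => w [/andP[]]].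
have infZ w : Z w -> inf Z <= w by apply: ge_inf; exact: Zinf.2.
have zst : s <= inf Z <= t.
  apply/andP; split; first by apply: lb_le_inf; [exists u|move=> w [/andP[]]].
  have /andP[_ ut] := ust; apply: le_trans ut; exact: infZ.
have z0 : phi (inf Z) = 0.
  apply/eqP/negPn/negP => zn0.
  have z_gt0 : 0 < phi (inf Z) by rewrite lt_neqAle eq_sym zn0 phi0.
  have [d d0 H] := near_phi zst z_gt0.
  have [w [wst w0] wz] := inf_adherent d0 Zinf.
  have wz' : inf Z <= w by exact: infZ.
  have := H w wst; rewrite w0 sub0r normrN (gtr0_norm z_gt0) ltxx.
  by rewrite ger0_norm ?subr_ge0// ltrBlDl => /(_ wz).
exists (inf Z); split => // w /andP[sw wz].
have wst : s <= w <= t by rewrite sw (le_trans (ltW wz)); case/andP: zst.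
rewrite lt_neqAle phi0// andbT eq_sym; apply/negP => /eqP w0.
have : inf Z <= w by exact: infZ.
by rewrite leNgt wz.
Qed.

(** If [phi t] were positive, then after its last zero [z] the function would
    be positive, hence nonincreasing, yet it tends to 0 at [z]. *)
Lemma zero_absorbing :
  (forall a b, s <= a -> a <= b -> b <= t ->
    (forall u, a <= u <= b -> 0 < phi u) -> phi b <= phi a) ->
  (exists2 u, s <= u <= t & phi u = 0) -> phi t = 0.
Proof.
move=> mono /last_zero[z [zst z0 zpos]].
have /andP[sz zt] := zst.
apply/eqP/negPn/negP => tn0.
have t_gt0 : 0 < phi t by rewrite lt_neqAle eq_sym tn0 phi0// st lexx.
have {}zt : z < t.
  by rewrite lt_neqAle zt andbT; apply: contraNneq tn0 => <-; rewrite z0.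
have [d d0 H] := near_phi zst t_gt0.
pose w := Num.min (z + d / 2) t.
have zw : z < w by rewrite lt_min zt andbT ltrDl divr_gt0.
have wt : w <= t by rewrite ge_min lexx orbT.
have wd : w <= z + d / 2 by rewrite ge_min lexx.
have sw : s <= w by rewrite (le_trans sz)// ltW.
have := H w; rewrite z0 subr0 sw wt => /(_ erefl).
rewrite (ger0_norm (phi0 _)) ?sw ?wt// gtr0_norm ?subr_gt0// => /(_ _) K.
have : phi t <= phi w.
  apply: mono => // u /andP[wu ut]; apply: zpos.
  by rewrite ut (lt_le_trans zw).
by rewrite leNgt K//; lra.
Qed.

End zeros.

(** * The Lyapunov function along a solution *)

Section Lyapunov_function.
Context {R : realType} {n : nat} (f : 'rV[R]_n -> 'rV[R]_n)
  (V : 'rV[R]_n -> R) (P : R -> 'rV[R]_n -> Prop).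
Hypothesis cV : continuous V.
Hypothesis pdV : positive_definite V.
Hypothesis dV : derivative_along_solutions f V P.

Lemma positive_definite_ge0 x : 0 <= V x.
Proof.
have [->|/pdV.2/ltW//] := eqVneq x 0.
by rewrite pdV.1.
Qed.

Lemma positive_definite_eq0 x : V x = 0 -> x = 0.
Proof.
by move=> Vx0; apply/eqP/negPn/negP => /pdV.2; rewrite Vx0 ltxx.
Qed.

Context {x0 : 'rV[R]_n} {tau : \bar R} {x : R -> 'rV[R]_n}.
Hypothesis sx : is_solution f x0 tau x.

Lemma solution_continuous (s t : R) : 0 <= s -> time_domain tau t ->
  {within `[s, t], continuous x}.
Proof.
move=> s0 tt; apply/subspace_continuousP => u; rewrite /= in_itv/= => /andP[su ut].
have [_ _ /(_ u (time_domain_le (le_trans s0 su) ut tt))] := sx.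
move=> /has_deriv_in_continuous; apply: cvg_trans; apply: cvg_app.
apply: within_subset => w /=; rewrite in_itv/= => /andP[sw wt].
exact: time_domain_le (le_trans s0 sw) wt tt.
Qed.

Lemma Lyapunov_continuous (s t : R) : 0 <= s -> time_domain tau t ->
  {within `[s, t], continuous (V \o x)}.
Proof.
move=> s0 tt; have /subspace_continuousP cx := solution_continuous s0 tt.
apply/subspace_continuousP => u ust.
by apply: (cvg_comp _ _ (cx u ust)); exact: cV.
Qed.

(** The outer function [phi] is the identity for the monotonicity of [V] and
    the time profile [G] for the settling time. *)
Lemma Lyapunov_MVT (phi dphi : R -> R) (s t : R) :
  0 <= s -> s < t -> time_domain tau t ->
  (forall u, s <= u <= t -> x u != 0) ->
  (forall v : R, 0 < v -> is_derive v 1 phi (dphi v)) ->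
  exists c d, [/\ P d (x c), x c != 0 &
    phi (V (x t)) - phi (V (x s)) = dphi (V (x c)) * d * (t - s)].
Proof.
move=> s0 st tt xn0 dphiP.
have der u : s < u < t -> exists d,
    P d (x u) /\ is_derive u 1 (phi \o (V \o x)) (dphi (V (x u)) * d).
  move=> /andP[su ut]; have u0 : 0 < u by rewrite (le_lt_trans s0).
  have utau : time_domain tau u by exact: time_domain_le (ltW u0) (ltW ut) tt.
  have xu0 : x u != 0 by rewrite xn0// !ltW.
  have [d du Pd] := dV sx utau xu0; exists d; split => //.
  apply: is_derive1_comp; first exact/dphiP/pdV.2.
  apply: has_deriv_in_is_derive du.
  by apply: time_domain_nbhs => //; exact: utau.2.
have [||c] := @MVT R (phi \o (V \o x)) ('D_1 (phi \o (V \o x))) s t st.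
- move=> u; rewrite in_itv/= => /der[d [_ du]].
  by apply/derivableP; have [] := du.
- have cVx := Lyapunov_continuous s0 tt.
  apply/subspace_continuousP => u /= ust.
  move/subspace_continuousP/(_ u ust) : cVx => cVu.
  apply: (cvg_comp _ _ cVu).
  have Vxu : 0 < V (x u) by apply/pdV.2/xn0; move: ust; rewrite in_itv.
  have dphiu : differentiable phi (V (x u)).
    by apply/derivable1_diffP; have [] := dphiP _ Vxu.
  exact: differentiable_continuous dphiu.
rewrite in_itv/= => cst H; have [d [Pd dc]] := der c cst.
exists c, d; split => //.
  by apply: xn0; case/andP: cst => /ltW -> /ltW ->.
by rewrite /= in H; rewrite H; congr (_ * _); have [_ ->] := dc.
Qed.

Hypothesis P_le0 : forall d y, y != 0 -> P d y -> d <= 0.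

Let Lyapunov_mono (s t : R) a b : 0 <= s -> time_domain tau t ->
  s <= a -> a <= b -> b <= t ->
  (forall u, a <= u <= b -> 0 < (V \o x) u) -> (V \o x) b <= (V \o x) a.
Proof.
move=> s0 tt sa ab bt Vpos.
have [->//|nab] := eqVneq a b.
have {}ab : a < b by rewrite lt_neqAle nab.
have a0 : 0 <= a by exact: le_trans sa.
have tb : time_domain tau b by apply: time_domain_le tt => //; exact: le_trans (ltW ab).
have xn0 u : a <= u <= b -> x u != 0.
  by move=> /Vpos /=; apply: contraTneq => ->; rewrite pdV.1 ltxx.
have did (v : R) : 0 < v -> is_derive v 1 id 1 by move=> _; exact: is_derive_id.
have [c [d [Pd xc0 E]]] := @Lyapunov_MVT id (fun=> 1) a b a0 ab tb xn0 did.
rewrite -subr_le0 /= E mul1r mulr_le0_ge0 ?subr_ge0 ?(ltW ab)//.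
exact: P_le0 Pd.
Qed.

Lemma zero_absorbing_solution (s t : R) : 0 <= s -> s <= t ->
  time_domain tau t -> x s = 0 -> x t = 0.
Proof.
move=> s0 st tt xs0; apply: positive_definite_eq0.
apply: (zero_absorbing st (Lyapunov_continuous s0 tt)).
- by move=> u _; exact: positive_definite_ge0.
- by move=> a b *; exact: (Lyapunov_mono s0 tt).
- by exists s; rewrite ?lexx//= xs0 pdV.1.
Qed.

Lemma Lyapunov_nonincreasing (s t : R) : 0 <= s -> s <= t ->
  time_domain tau t -> V (x t) <= V (x s).
Proof.
move=> s0 st tt.
have [[u /andP[su ut] xu0]|H] := pselect (exists2 u, s <= u <= t & x u = 0).
  have -> : x t = 0.
    exact: (zero_absorbing_solution (le_trans s0 su) ut tt xu0).
  by rewrite pdV.1 positive_definite_ge0.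
apply: (@Lyapunov_mono s t) => // u ust; apply: pdV.2.
by apply/eqP => xu0; apply: H; exists u.
Qed.

End Lyapunov_function.

(** * A mean value inequality and a retraction onto balls *)

Lemma coord_norm_le (R : realType) (n : nat) (v : 'rV[R]_n) (j : 'I_n) :
  `|v ord0 j| <= `|v|.
Proof.
rewrite [leRHS]/Num.norm/= mx_normrE; apply/bigmax_geP; right => /=.
by exists (ord0, j).
Qed.

Lemma rV_norm_le (R : realType) (n : nat) (v : 'rV[R]_n) (c : R) : 0 <= c ->
  (forall j, `|v ord0 j| <= c) -> `|v| <= c.
Proof.
move=> c0 vc; rewrite [leLHS]/Num.norm/= mx_normrE; apply/bigmax_leP; split => //.
by move=> [i j] _ /=; rewrite ord1.
Qed.

(** The norm is the maximum of the coordinates, and the mean value theorem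
    applies to each of them, with an intermediate time of its own. *)
Lemma solution_MVI (R : realType) (n : nat) (f : 'rV[R]_n -> 'rV[R]_n)
    (x0 : 'rV[R]_n) (tau : \bar R) (x : R -> 'rV[R]_n) (v : 'rV[R]_n)
    (e s t : R) :
  is_solution f x0 tau x -> 0 <= s -> s <= t -> time_domain tau t -> 0 <= e ->
  (forall u, s <= u <= t -> `|f (x u) - v| <= e) ->
  `|x t - x s - (t - s) *: v| <= e * (t - s).
Proof.
move=> sx s0 st tt e0 K.
have [<-|nst] := eqVneq s t.
  by rewrite !subrr scale0r subr0 normr0 mulr0.
have {}st : s < t by rewrite lt_neqAle nst.
apply: rV_norm_le => [|j]; first by rewrite mulr_ge0// subr_ge0 ltW.
have cx := solution_continuous sx s0 tt.
have [||c] := @MVT R (fun u => x u ord0 j) (fun u => f (x u) ord0 j) s t st.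
- move=> u; rewrite in_itv/= => /andP[su ut].
  have u0 : 0 < u by rewrite (le_lt_trans s0).
  have utau : time_domain tau u by exact: time_domain_le (ltW u0) (ltW ut) tt.
  apply: (@has_deriv_in_is_derive _ (time_domain tau)).
    by apply: time_domain_nbhs => //; exact: utau.2.
  have [_ _ /(_ u utau)/has_deriv_inP H] := sx.
  apply/has_deriv_inP => eps eps0; have [del del0 {}H] := H _ eps0.
  exists del => // w wtau wd; apply: le_trans (H _ wtau wd).
  by apply: le_trans (coord_norm_le _ j); rewrite !mxE.
- move/subspace_continuousP : cx => cx; apply/subspace_continuousP => u ust.
  apply: (cvg_comp x (fun w : 'rV[R]_n => w ord0 j) (cx u ust)).
  exact: coord_continuous.
rewrite in_itv/= => /andP[sc ct] E.
rewrite !mxE E mulrC -mulrBr normrM mulrC.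
rewrite [X in _ * X]ger0_norm ?subr_ge0 ?(ltW st)// ler_wpM2r ?subr_ge0 ?(ltW st)//.
have := K c; rewrite (ltW sc) (ltW ct) => /(_ erefl); apply: le_trans.
by apply: le_trans (coord_norm_le _ j); rewrite !mxE.
Qed.

Lemma cvg_maxr (R : realType) (T : Type) (F : set_system T) {FF : Filter F}
    (g1 g2 : T -> R) (a b : R) :
  g1 @ F --> a -> g2 @ F --> b -> Num.max (g1 x) (g2 x) @[x --> F] --> Num.max a b.
Proof.
move=> ga gb; under eq_cvg do rewrite maxr_absE; rewrite maxr_absE.
apply: cvgM; last exact: cvg_cst.
by apply: cvgD; [exact: cvgD|apply: cvg_norm; exact: cvgB].
Qed.

Definition retract (R : realType) (W : normedModType R) (r : R) (y : W) : W :=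
  (r / Num.max r `|y|) *: y.

Section retract.
Context {R : realType} {W : normedModType R} (r : R) (r0 : 0 < r).

Lemma retract_norm_le (y : W) : `|retract r y| <= r.
Proof.
have m0 : 0 < Num.max r `|y| by rewrite lt_max r0.
rewrite normrZ (ger0_norm (divr_ge0 (ltW r0) (ltW m0))) mulrAC ler_pdivrMr//.
by rewrite ler_pM2l// le_max lexx orbT.
Qed.

Lemma retract_id (y : W) : `|y| <= r -> retract r y = y.
Proof. by move=> yr; rewrite /retract max_l// divff ?scale1r// gt_eqF. Qed.

Lemma retract_continuous : continuous (@retract R W r).
Proof.
move=> y; apply: cvgZ; last exact: cvg_id.
have m0 : 0 < Num.max r `|y| by rewrite lt_max r0.
apply: cvgM; first exact: cvg_cst.
apply: cvgV; first by rewrite gt_eqF.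
apply: cvg_maxr; first exact: cvg_cst.
by apply: cvg_norm; exact: cvg_id.
Qed.

End retract.

(** * Existence for all times *)

Section global_existence.
Context {R : realType} {n : nat} (f : 'rV[R]_n -> 'rV[R]_n)
  (V : 'rV[R]_n -> R) (P : R -> 'rV[R]_n -> Prop).
Hypothesis cf : continuous f.
Hypothesis cV : continuous V.
Hypothesis pdV : positive_definite V.
Hypothesis ruV : radially_unbounded V.
Hypothesis dV : derivative_along_solutions f V P.
Hypothesis P_le0 : forall d y, y != 0 -> P d y -> d <= 0.

Lemma sublevel_bounded (c : R) : exists2 r : R, 0 < r &
  forall y, V y <= c -> `|y| < r.
Proof.
have [r Vr] := ruV (c + 1).
exists (Num.max r 1); first by rewrite lt_max ltr01 orbT.
move=> y Vy; rewrite ltNge; apply/negP; rewrite ge_max => /andP[/Vr ry _].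
by have := le_trans ry Vy; rewrite gerDl leNgt ltr01.
Qed.

Lemma bounded_on_ball (r : R) : exists2 M : R, 0 <= M &
  forall y, `|y| <= r -> `|f y| <= M.
Proof.
have : compact (f @` [set y | `|y| <= r]).
  apply: continuous_compact; first exact: continuous_subspaceT.
  have := @compact_norm_ball _ _ (@bounded_closed_compact R n) 0 r.
  by under eq_set do rewrite subr0.
move=> /compact_bounded[M [_ fM]].
exists (Num.max (M + 1) 0); first by rewrite le_max lexx orbT.
move=> y yr; apply: (le_trans (fM (M + 1) _ (f y) _)).
- by rewrite ltrDl.
- by exists y.
- by rewrite le_max lexx.
Qed.

(** Here [g] is [f] composed with a retraction onto a ball that contains in its
    interior the sublevel set of [V x0].  At the first time [z] where a
    [g]-solution reaches the boundary of the ball it has been an [f]-solution,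
    so [V (x z) <= V x0] by continuity, which places [x z] in the interior. *)
Lemma global_solution_exists (x0 : 'rV[R]_n) : exists x, is_global_solution f x0 x.
Proof.
have [r r0 Vr] := sublevel_bounded (V x0).
have [M M0 fM] := bounded_on_ball r.
pose g y := f (retract r y).
have cg : continuous g.
  by move=> y; apply: continuous_comp; [exact: retract_continuous|exact: cf].
have gM y : `|g y| <= M by exact/fM/retract_norm_le.
have [x [xE dx]] := Peano_bounded x0 (@bounded_closed_compact R n) cg gM.
have dgx (t : R) : 0 <= t -> has_deriv_in (time_domain +oo%E) x t (g (x t)).
  move=> t0; apply/has_deriv_inP => eps eps0.
  have [d d0 H] := dx t eps t0 eps0.
  by exists d => // s [s0 _]; exact: H.
suff xr (t : R) : 0 <= t -> `|x t| < r.
  exists x; split => //.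
  move=> t [t0 _]; have := dgx t t0.
  by rewrite /g retract_id// ltW// xr.
move=> t0; rewrite ltNge; apply/negP => rxt.
have gsol : is_solution g x0 +oo%E x.
  by split => // t' [t'0 _]; exact: dgx.
have tt : time_domain (+oo%E : \bar R) t by split => //; rewrite ltry.
have /subspace_continuousP cx := solution_continuous gsol (lexx 0) tt.
(* [phi] vanishes exactly when [x] is not in the open ball. *)
pose phi u := Num.max 0 (r - `|x u|).
have cphi : {within `[0, t], continuous phi}.
  apply/subspace_continuousP => u ust.
  have cu : `|x w| @[w --> within `[0, t] (nbhs u)] --> `|x u|.
    by apply: cvg_norm; exact: cx.
  apply: cvg_maxr; first exact: cvg_cst.
  by apply: cvgB; [exact: cvg_cst|exact: cu].
have phi0 u : 0 <= u <= t -> 0 <= phi u by rewrite le_max lexx.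
have [|z [/andP[z0 zt] phiz zpos]] := first_zero cphi phi0.
  by exists t; rewrite ?t0 ?lexx// /phi max_l// subr_le0.
have xr u : 0 <= u < z -> `|x u| < r.
  by move=> /zpos; rewrite lt_max ltxx/= subr_gt0.
have rz : r <= `|x z|.
  by rewrite -subr_le0 -phiz le_max lexx orbT.
have {}z0 : 0 < z.
  rewrite lt_neqAle z0 andbT; apply: contraTneq rz => <-.
  by rewrite -ltNge xE; exact: Vr.
have fsol : is_solution f x0 z%:E x.
  split => // u [u0 uz]; rewrite lte_fin in uz.
  have /has_deriv_inP H := dgx u u0; apply/has_deriv_inP => eps eps0.
  have [d d0 {}H] := H _ eps0; exists d => // s [s0 sz] sd.
  have -> : f (x u) = g (x u) by rewrite /g retract_id// ltW// xr// u0.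
  by apply: H => //; split => //; rewrite ltry.
have Vxu u : 0 <= u < z -> V (x u) <= V x0.
  move=> /andP[u0 uz]; rewrite -xE.
  by apply: (Lyapunov_nonincreasing cV pdV dV fsol P_le0).
have : V x0 < V (x z).
  by rewrite ltNge; apply/negP => /Vr; rewrite ltNge rz.
rewrite -subr_gt0 => Vz.
have cVx : {within `[0, t], continuous (V \o x)}.
  apply/subspace_continuousP => u ust.
  by apply: (cvg_comp _ _ (cx u ust)); exact: cV.
have zt' : 0 <= z <= t by rewrite (ltW z0).
have [d d0 H] := within_itv_dist cVx zt' Vz.
pose w := Num.max 0 (z - d / 2).
have wz : w < z by rewrite gt_max z0/= ltrBlDr ltrDl divr_gt0.
have w0 : 0 <= w by rewrite le_max lexx.
have wd : z - d / 2 <= w by rewrite le_max lexx orbT.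
have := H w; rewrite w0 (le_trans (ltW wz) zt) => /(_ erefl).
rewrite ltr0_norm ?subr_lt0// => /(_ _) K.
have := Vxu w; rewrite w0 wz => /(_ erefl).
have {}K : `|(V \o x) w - (V \o x) z| < V (x z) - V x0 by apply: K; lra.
by move: K; rewrite ltr_distlC /=; lra.
Qed.

Lemma solution_bounded (x0 : 'rV[R]_n) : exists2 M : R, 0 <= M &
  forall tau x, is_solution f x0 tau x ->
  forall t, time_domain tau t -> `|f (x t)| <= M.
Proof.
have [r r0 Vr] := sublevel_bounded (V x0).
have [M M0 fM] := bounded_on_ball r.
exists M => // tau x sx t tt; apply/fM/ltW/Vr.
have [_ {1}<- _] := sx.
by apply: (Lyapunov_nonincreasing cV pdV dV sx P_le0) => //; exact: tt.1.
Qed.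

End global_existence.

(** * Continuation of solutions *)

Section continuation.
Context {R : realType} {n : nat} (f : 'rV[R]_n -> 'rV[R]_n) (cf : continuous f).
Context {x0 : 'rV[R]_n} {r : R} {x : R -> 'rV[R]_n} (M : R).
Hypothesis sx : is_solution f x0 r%:E x.
Hypothesis M0 : 0 <= M.
Hypothesis fM : forall t, time_domain r%:E t -> `|f (x t)| <= M.

Let lip (s t : R) : 0 <= s -> s <= t -> time_domain r%:E t ->
  `|x t - x s| <= M * (t - s).
Proof.
move=> s0 st tt; have := solution_MVI (v := 0) sx s0 st tt M0.
rewrite scaler0 subr0; apply=> u /andP[su ut]; rewrite subr0; apply: fM.
exact: time_domain_le (le_trans s0 su) ut tt.
Qed.

Let r0 : 0 < r. Proof. by case: sx; rewrite lte_fin. Qed.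

(** A bounded speed makes the solution Lipschitz, so it has an endpoint, where
    by continuity of [f] it also has the left derivative that the equation
    prescribes. *)
Lemma solution_endpoint : exists L : 'rV[R]_n, forall eps : R, 0 < eps ->
  exists2 d : R, 0 < d & forall s : R, 0 <= s -> s < r -> r - s < d ->
    `|L - x s - (r - s) *: f L| <= eps * (r - s).
Proof.
have [U [UU rU]] := ultraFilterLemma (at_left_proper_filter r).
have PU : ProperFilter U by exact: ultra_proper.
have Ult (s : R) : s < r -> \forall t \near U, s < t < r.
  move=> sr; apply: rU; apply: filterS (filterI (nbhs_left_gt sr) (nbhs_left_lt r)).
  by move=> t [? ?]; apply/andP.
have [L xL] : exists L : 'rV[R]_n, x @ U --> L.
  apply: (@ultra_cvg_compact _ _ _ _ [set y | `|y - x 0| <= M * r] UU).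
    exact: (@compact_norm_ball _ _ (@bounded_closed_compact R n)).
  apply: filterS (Ult 0 r0) => t /andP[t0 tr].
  have tt : time_domain r%:E t by split; [exact: ltW|rewrite lte_fin].
  apply: le_trans (lip (lexx _) (ltW t0) tt) _.
  by rewrite subr0 ler_wpM2l// ltW.
have MVIr (v : 'rV[R]_n) (e s : R) : 0 <= e -> 0 <= s -> s < r ->
    (forall u, s <= u < r -> `|f (x u) - v| <= e) ->
    `|L - x s - (r - s) *: v| <= e * (r - s).
  move=> e0 s0 sr K.
  have idU : t @[t --> U] --> r.
    apply: cvg_trans (_ : t @[t --> r^'-] --> r); last first.
      by apply: cvg_at_left_filter; exact: cvg_id.
    exact: rU.
  have cl : `|x t - x s - (t - s) *: v| @[t --> U] --> `|L - x s - (r - s) *: v|.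
    apply: cvg_norm; apply: cvgB; first by apply: cvgB => //; exact: cvg_cst.
    by apply: cvgZr_tmp; apply: cvgB => //; exact: cvg_cst.
  have cr : e * (t - s) @[t --> U] --> e * (r - s).
    by apply: cvgM; [exact: cvg_cst|apply: cvgB => //; exact: cvg_cst].
  apply: ler_cvg_to cl cr _.
  apply: filterS (Ult s sr) => t /andP[st tr].
  apply: (solution_MVI sx s0 (ltW st)) => //.
    by split; [exact: le_trans (ltW st)|rewrite lte_fin].
  by move=> u /andP[su ut]; apply: K; rewrite su (le_lt_trans ut).
exists L => eps eps0.
have /cvgrPdist_le/(_ _ eps0)/nbhs_ballP[rho /= rho0 frho] := @cf L.
have M1 : 0 < M + 1 by rewrite ltr_wpDl.
(* The Lipschitz bound then keeps [x u] within [rho] of the endpoint. *)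
exists (rho / (M + 1)); first exact: divr_gt0.
move=> s s0 sr; rewrite ltr_pdivlMr// => srho.
apply: (MVIr (f L)) => //; first exact: ltW.
move=> u /andP[su ur]; rewrite distrC; apply: frho; rewrite -ball_normE/=.
have u0 : 0 <= u by exact: le_trans su.
have := MVIr 0 M u M0 u0 ur; rewrite scaler0 subr0 => H.
apply: le_lt_trans (H _) _.
  move=> w /andP[uw wr]; rewrite subr0; apply: fM.
  by split; [exact: le_trans uw|rewrite lte_fin].
have : M * (r - u) <= M * (r - s) by rewrite ler_wpM2l// lerD2l lerN2.
lra.
Qed.

(** A global solution from the endpoint is glued on; at the junction the left
    derivative comes from [solution_endpoint], the right one from [y]. *)
Lemma solution_extension :
  (forall y0, exists y, is_global_solution f y0 y) ->
  exists2 z, is_global_solution f x0 z &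
    forall t, time_domain r%:E t -> z t = x t.
Proof.
move=> ex; have [L HL] := solution_endpoint.
have [y [_ y0 dy]] := ex L.
pose z t := if t < r then x t else y (t - r).
have zx t : t < r -> z t = x t by rewrite /z => ->.
have zy t : r <= t -> z t = y (t - r) by rewrite /z leNgt => /negbTE ->.
exists z => [|t [_]]; last by rewrite lte_fin; exact: zx.
have [_ xE dx] := sx.
split; [by []|by rewrite zx|move=> t [t0 _]; apply/has_deriv_inP => eps eps0].
have [tr|rt] := ltP t r.
  have tt : time_domain r%:E t by split.
  have /has_deriv_inP/(_ _ eps0)[d d0 H] := dx t tt.
  exists (Num.min d (r - t)); first by rewrite lt_min d0 subr_gt0.
  move=> s [s0 _]; rewrite lt_min => /andP[sd sr].
  have {}sr : s < r by have := ler_norm (s - t); lra.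
  by rewrite !zx//; apply: H.
have tr0 : time_domain (+oo%E : \bar R) (t - r) by split; rewrite ?subr_ge0// ltry.
have /has_deriv_inP/(_ _ eps0)[d d0 H] := dy _ tr0.
have Hright s : r <= s -> `|s - t| < d ->
    `|z s - z t - (s - t) *: f (z t)| <= eps * `|s - t|.
  move=> rs sd; rewrite !zy//.
  have := H (s - r); rewrite opprB addrA subrK; apply => //.
  by split; rewrite ?subr_ge0// ltry.
have [trE|tnr] := eqVneq t r.
  have [d' d'0 H'] := HL eps eps0.
  exists (Num.min d d'); first by rewrite lt_min d0.
  move=> s [s0 _]; rewrite lt_min => /andP[sd sd'].
  have [sr|] := ltP s r; last by move=> rs; exact: Hright.
  have zt : z t = L by rewrite zy// trE subrr.
  have rs0 : 0 <= r - s by rewrite subr_ge0 ltW.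
  rewrite zt zx// trE (distrC s r) (ger0_norm rs0).
  have -> : x s - L - (s - r) *: f L = - (L - x s - (r - s) *: f L).
    by rewrite opprB opprB addrC -scaleNr opprB.
  rewrite normrN; apply: H' => //.
  by move: sd'; rewrite trE (distrC s r) (ger0_norm rs0).
have {}rt : r < t by rewrite lt_neqAle eq_sym tnr.
exists (Num.min d (t - r)); first by rewrite lt_min d0 subr_gt0.
move=> s [s0 _]; rewrite lt_min => /andP[sd sr]; apply: Hright => //.
by move: sr; rewrite ltr_norml => /andP[+ _]; lra.
Qed.

End continuation.

(** * Lyapunov stability *)

Section stability.
Context {R : realType} {n : nat} (f : 'rV[R]_n -> 'rV[R]_n)
  (V : 'rV[R]_n -> R) (P : R -> 'rV[R]_n -> Prop).
Hypothesis cf : continuous f.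
Hypothesis cV : continuous V.
Hypothesis pdV : positive_definite V.
Hypothesis ruV : radially_unbounded V.
Hypothesis dV : derivative_along_solutions f V P.
Hypothesis P_le0 : forall d y, y != 0 -> P d y -> d <= 0.

Lemma every_solution_exists_forever (x0 : 'rV[R]_n) : solutions_exist_forever f x0.
Proof.
have ex := global_solution_exists cf cV pdV ruV dV P_le0.
split=> [|tau x [sx maxx]]; first exact: ex.
case: tau sx maxx => [r||] sx maxx //; last by case: sx.
have [M M0 fM] := solution_bounded cf cV pdV ruV dV P_le0 x0.
have [z sz zx] := solution_extension cf sx M0 (fM _ _ sx) ex.
by have := maxx +oo%E z (leey _) sz zx.
Qed.

(** Radial unboundedness handles the points far away; on the compact annulus
    that remains, [V] has a positive minimum. *)
Lemma sublevel_in_ball (eps : R) : 0 < eps -> exists2 m : R, 0 < m &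
  forall y, V y < m -> `|y| < eps.
Proof.
move=> eps0; have [r r0 Vr] := sublevel_bounded ruV 1.
pose A := [set y : 'rV[R]_n | eps <= `|y| <= r].
have [A0|/set0P/negP/negPn/eqP A0] := pselect (A !=set0); last first.
  exists 1 => // y y1; rewrite ltNge; apply/negP => epsy.
  have : A y by rewrite /A/= epsy/= ltW// Vr// ltW.
  by rewrite A0.
have cA : compact A.
  apply: bounded_closed_compact.
    exists r; split; first exact: num_real.
    by move=> m rm y /= /andP[_ yr]; rewrite (le_trans yr)// ltW.
  have -> : A = Num.norm @^-1` `[eps, r]%classic.
    by apply/seteqP; split => y /=; rewrite in_itv.
  apply: closed_comp; last exact: interval_closed.
  by move=> y _; exact: norm_continuous.
have [c cA' Vc] := EVT_min_rV A0 cA (continuous_subspaceT cV).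
have c0 : 0 < V c.
  apply: pdV.2; move: cA'; rewrite inE => -[/andP[epsc _]].
  by rewrite -normr_gt0 (lt_le_trans eps0).
exists (Num.min 1 (V c)); first by rewrite lt_min ltr01.
move=> y; rewrite lt_min => /andP[y1 yc]; rewrite ltNge; apply/negP => epsy.
have : V c <= V y by apply: Vc; rewrite inE /A/= epsy/= ltW// Vr// ltW.
by rewrite leNgt yc.
Qed.

Lemma Lyapunov_theorem : lyapunov_stable f.
Proof.
move=> eps eps0; have [m m0 Vm] := sublevel_in_ball eps0.
have /cvgrPdist_lt/(_ _ m0)/nbhs_ballP[d /= d0 Vd] := @cV 0.
exists d => // x0 x0d; split; first exact: every_solution_exists_forever.
move=> x sx t t0; apply: Vm.
have tt : time_domain (+oo%E : \bar R) t by split; rewrite ?ltry.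
apply: le_lt_trans (Lyapunov_nonincreasing cV pdV dV sx P_le0 (lexx _) t0 tt) _.
have [_ -> _] := sx.
have := Vd x0; rewrite -ball_normE/= sub0r normrN => /(_ x0d).
by rewrite pdV.1 sub0r normrN; apply: le_lt_trans; exact: ler_norm.
Qed.

End stability.

(** * Bounds on the settling time *)

Section settling.
Context {R : realType} {n : nat} (f : 'rV[R]_n -> 'rV[R]_n)
  (V : 'rV[R]_n -> R) (P : R -> 'rV[R]_n -> Prop).
Hypothesis cV : continuous V.
Hypothesis pdV : positive_definite V.
Hypothesis dV : derivative_along_solutions f V P.
Hypothesis P_le0 : forall d y, y != 0 -> P d y -> d <= 0.
Context (G dG : R -> R) (a : R).
Hypothesis a0 : 0 < a.
Hypothesis G0 : G 0 = 0.
Hypothesis Gpos : forall v : R, 0 < v -> 0 < G v.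
Hypothesis dGP : forall v : R, 0 < v -> is_derive v 1 G (dG v).

(** While the solution avoids the origin, the positive quantity [G (V (x t))] has
    slope at most [- a] in [t]. *)
Lemma vanishes_after_profile (x0 : 'rV[R]_n) :
  (forall d y, y != 0 -> P d y -> dG (V y) * d <= - a) ->
  vanishes_after f x0 (G (V x0) / a).
Proof.
move=> decay x sx t Tt; have [_ xE _] := sx.
have GV0 y : 0 <= G (V y).
  have [->|/pdV.2/Gpos/ltW//] := eqVneq y 0; by rewrite pdV.1 G0.
have t0 : 0 <= t by rewrite (le_trans _ Tt)// divr_ge0// ltW.
have tt : time_domain (+oo%E : \bar R) t by split; rewrite ?ltry.
apply/eqP/negPn/negP => xt0.
have xn0 u : 0 <= u <= t -> x u != 0.
  move=> /andP[u0 ut]; apply: contraNneq xt0 => xu0.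
  by apply/eqP; exact: (zero_absorbing_solution cV pdV dV sx P_le0 u0 ut tt xu0).
have Gt : 0 < G (V (x t)) by exact/Gpos/pdV.2.
rewrite ler_pdivrMr// -xE in Tt.
have [t00|nt0] := eqVneq t 0.
  by move: Tt; rewrite t00 mul0r leNgt; rewrite t00 in Gt; rewrite Gt.
have {}t0 : 0 < t by rewrite lt_neqAle eq_sym nt0.
have [c [d [Pd xc0 E]]] := Lyapunov_MVT cV pdV dV sx (lexx _) t0 tt xn0 dGP.
have : dG (V (x c)) * d * (t - 0) <= - a * t.
  by rewrite subr0; apply: ler_wpM2r; [exact: ltW|exact: decay].
rewrite -E; lra.
Qed.

Hypothesis G_cvg0 : forall eps : R, 0 < eps ->
  exists2 d : R, 0 < d & forall v : R, 0 < v < d -> G v < eps.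

(** Until the first zero [z] of the solution the slope of [G (V (x t))] is
    exactly [- a], and [G (V (x t))] tends to 0 at [z], so [z = G (V x0) / a]. *)
Lemma profile_le_vanishing_time (x0 : 'rV[R]_n) (T : R) :
  (forall d y, y != 0 -> P d y -> dG (V y) * d = - a) ->
  (exists x, is_global_solution f x0 x) ->
  0 <= T -> vanishes_after f x0 T -> G (V x0) / a <= T.
Proof.
move=> decay [x sx] T0 /(_ x sx) xT; have [_ xE _] := sx.
have dom t : 0 <= t -> time_domain (+oo%E : \bar R) t by split; rewrite ?ltry.
have cVx := Lyapunov_continuous cV sx (lexx _) (dom T T0).
have [|z [/andP[z0 zT] Vz Vpos]] := first_zero cVx
    (fun u _ => positive_definite_ge0 pdV (x u)).
  by exists T; rewrite ?T0 ?lexx//= xT// pdV.1.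
apply: (le_trans _ zT); rewrite ler_pdivrMr//.
have [z00|nz0] := eqVneq z 0.
  by move: Vz; rewrite z00 /= xE => ->; rewrite G0 mul0r.
have {}z0 : 0 < z by rewrite lt_neqAle eq_sym nz0.
rewrite leNgt; apply/negP => zG.
have e0 : 0 < G (V x0) - z * a by rewrite subr_gt0.
have [d d0 Gd] := G_cvg0 e0.
have zT' : 0 <= z <= T by rewrite (ltW z0).
have [del del0 Hdel] := within_itv_dist cVx zT' d0.
(* A time before [z], close enough for [V (x w) < d], but positive. *)
pose w := Num.max (z / 2) (z - del / 2).
have w0 : 0 < w by rewrite lt_max divr_gt0.
have wz : w < z by rewrite gt_max; apply/andP; split; lra.
have wd : z - del / 2 <= w by rewrite le_max lexx orbT.
have Vw : 0 < V (x w) by apply: Vpos; rewrite (ltW w0).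
have Gw : G (V (x w)) < G (V x0) - z * a.
  apply: Gd; rewrite Vw/=.
  have := Hdel w; rewrite (ltW w0) (le_trans (ltW wz) zT) => /(_ erefl).
  rewrite Vz subr0 ltr0_norm ?subr_lt0// => /(_ _) H.
  by apply: le_lt_trans (H _); [exact: ler_norm|lra].
have xn0 u : 0 <= u <= w -> x u != 0.
  move=> /andP[u0 uw]; have : 0 < V (x u).
    by apply: Vpos; rewrite u0 (le_lt_trans uw).
  by apply: contraTneq => ->; rewrite pdV.1 ltxx.
have [c [d' [Pd xc0]]] :=
  Lyapunov_MVT cV pdV dV sx (lexx _) w0 (dom w (ltW w0)) xn0 dGP.
rewrite (decay _ _ xc0 Pd) xE subr0 => E.
have : w * a < z * a by rewrite ltr_pM2r.
lra.
Qed.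

End settling.

Theorem theorem2 (R : realType) (n : nat) (hn : (0 < n)%N)
    (f : 'rV[R]_n -> 'rV[R]_n) (hf : continuous f) (hf0 : f 0 = 0)
    (alpha beta p q k Tc : R)
    (halpha : 0 < alpha) (hbeta : 0 < beta) (hp : 0 < p) (hq : 0 < q)
    (hk : 0 < k) (hkp : k * p < 1) (hkq : 1 < k * q) (hTc : 0 < Tc) :
  let mp := (1 - k * p) / (q - p) in
  let mq := (k * q - 1) / (q - p) in
  let gamma := Gamma mp * Gamma mq / (alpha `^ k * Gamma k * (q - p))
               * (alpha / beta) `^ mp in
  let rate (v : R) :=
    - (gamma / Tc) * (alpha * v `^ p + beta * v `^ q) `^ k in
  forall V : 'rV[R]_n -> R,
    continuous V -> positive_definite V -> radially_unbounded V ->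
    derivative_along_solutions f V (fun d x => d <= rate (V x)) ->
    predefined_time_stable f Tc /\
    (derivative_along_solutions f V (fun d x => d = rate (V x)) ->
     strong_predefined_time f Tc).
Proof.
move=> mp mq gamma rate V cV pdV ruV dV.
have [G [G0 dG Gpos Gcvg0 [Gle Gapprox]]] :=
  settling_profile halpha hbeta hk hkp hkq.
rewrite -/mp -/mq -/gamma in Gle Gapprox.
pose w (v : R) := (alpha * v `^ p + beta * v `^ q) `^ k.
have w0 (v : R) : 0 < v -> 0 < w v.
  by move=> v0; rewrite powR_gt0// addr_gt0// mulr_gt0// powR_gt0.
have gamma0 : 0 < gamma := lt_le_trans (Gpos 1 ltr01) (Gle 1).
pose a := gamma / Tc; have a0 : 0 < a by rewrite divr_gt0.
have rate_le0 y : y != 0 -> rate (V y) <= 0.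
  by move=> y0; rewrite /rate mulNr oppr_le0 mulr_ge0 ?powR_ge0// ltW.
have dG_rate y : y != 0 -> (w (V y))^-1 * rate (V y) = - a.
  move=> y0; rewrite /rate -/(w _) mulrC mulfK// gt_eqF//.
  exact/w0/pdV.2.
have TcE v : G v / a <= Tc.
  by rewrite ler_pdivrMr// /a mulrCA divff ?mulr1 ?gt_eqF// Gle.
have P_le0 d y : y != 0 -> d <= rate (V y) -> d <= 0.
  by move=> /rate_le0 r0 /le_trans; exact.
have decay d y : y != 0 -> d <= rate (V y) -> (w (V y))^-1 * d <= - a.
  move=> y0 dr; rewrite -(dG_rate _ y0) ler_pM2l// invr_gt0.
  exact/w0/pdV.2.
have vanish x0 := vanishes_after_profile cV pdV dV P_le0 a0 G0 Gpos dG (x0 := x0) decay.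
have time_ge0 x0 : 0 <= G (V x0) / a.
  rewrite divr_ge0 ?(ltW a0)//.
  by have [->|/pdV.2/Gpos/ltW//] := eqVneq x0 0; rewrite pdV.1 G0.
have settle x0 : (settling_time f x0 <= Tc%:E)%E.
  apply: ge_ereal_inf; exists (G (V x0) / a)%:E; last by rewrite lee_fin.
  by exists (G (V x0) / a).
have pts : predefined_time_stable f Tc.
  split => //; split; last by exists Tc.
  split; first exact: (Lyapunov_theorem hf cV pdV ruV dV P_le0).
  move=> x0; split.
    exact: (every_solution_exists_forever hf cV pdV ruV dV P_le0).
  by exists (G (V x0) / a).
split => // dVeq; split => //.
apply/eqP; rewrite eq_le; apply/andP; split.
  by apply: ge_ereal_sup => _ [x0 _ <-]; exact: settle.
apply/lee_subgt0Pr => e e0.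
(* An initial state whose profile value exceeds [gamma (1 - e / Tc)] settles
   after [Tc - e]; far out on a diagonal [V] is large enough. *)
have : gamma * (1 - e / Tc) < gamma.
  by rewrite gtr_pMr// ltrBlDr ltrDl divr_gt0.
move=> /Gapprox[v0 _ Gv0].
have [r Vr] := ruV v0.
pose x0 : 'rV[R]_n := const_mx `|r|.
have x0r : r <= `|x0|.
  apply: le_trans (coord_norm_le x0 (Ordinal hn)).
  by rewrite mxE normr_id ler_norm.
apply: le_ereal_sup_tmp; exists (settling_time f x0); first by exists x0.
apply: le_ereal_inf_tmp => _ [T [T0 Tvan] <-].
rewrite -EFinB lee_fin.
have decay_eq d y : y != 0 -> d = rate (V y) -> (w (V y))^-1 * d = - a.
  by move=> y0 ->; exact: dG_rate.
have P_le0' d y : y != 0 -> d = rate (V y) -> d <= 0.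
  by move=> y0 ->; exact: rate_le0.
apply: le_trans (profile_le_vanishing_time cV pdV dVeq a0 G0 dG Gcvg0
  decay_eq (every_solution_exists_forever hf cV pdV ruV dVeq P_le0' x0).1 T0 Tvan).
rewrite ler_pdivlMr// /a.
have -> : (Tc - e) * (gamma / Tc) = gamma * (1 - e / Tc).
  by field; rewrite gt_eqF.
exact/ltW/Gv0/Vr.
Qed.
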